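(* Let $a \in \mathbb{C}\setminus\{\frac12,\frac32,\frac52,\dots\}$ and $z \in \mathbb{C}$, set $b = -4(a-\frac12)$, let $t_0$ be one of the two numbers $t_\pm = \frac12\big(z \pm \sqrt{z^2-b}\big)$, and let $d, \rho, \beta, \delta, f$ and $\kappa$ be as defined in the context. Suppose that the phases $\beta$ and $\delta$ are such that $\kappa$ is positive, and let $\alpha \in [0,\pi)$ be a corresponding angle as in the context. Consider the parabolic cylinder function $$U_a(z) = \begin{cases} U_a^+(z) & \text{if } \mathrm{Re}(t_0 e^{i\alpha}) < 0,\\ U_a^-(z) & \text{if } \mathrm{Re}(t_0 e^{i\alpha}) \geq 0.\end{cases}$$ Then, for an appropriate choice of the sign of the square root $\sqrt{-8d-b}$, this function can be approximated by $$\tilde{U}_a(z) = e^{-\frac{z^2}{4} + f(t_0)}\; t_0\; \frac{2\sqrt{2\pi}}{\sqrt{-8d-b}},$$ with relative error bounded by $$\left| \frac{U_a(z)}{\tilde{U}_a(z)} - 1 \right| \leq \frac{\sqrt{|8d+b|}\,|b|}{\kappa^2\,|d|^2} \left( 1 + \log^2\bigg( 1 + \frac{(\kappa\,|d|)^{3/2}}{|b|} \bigg) \right).$$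
   Context: The parabolic cylinder functions are $$U_a^\pm(z) = e^{-\frac{z^2}{4}} \int_{\Gamma_\pm} e^{zt - \frac{t^2}{2}}\, t^{a-\frac12}\,dt = e^{-\frac{z^2}{4}} \int_{\Gamma_\pm} e^{f(t)}\,dt, \qquad \Gamma_\pm = \mathbb{R} \pm i,$$ with $\Gamma_\pm$ running from $-\infty\pm i$ to $\infty \pm i$, where $t^{a-\frac12} = \exp((a-\frac12)\log t)$, the logarithm has its branch cut along the negative real axis, and $$f(t) = zt - \frac{t^2}{2} - \frac{b}{4}\log t.$$ The points $t_\pm$ are the zeros of $f'$; since $b\ne 0$, $t_\pm \neq 0$. Set $$d := -\frac{t_0^2}{2}, \qquad \rho := \left|\frac{b}{8d}\right|, \qquad b = |b|e^{i\beta},\quad d = |d|e^{i\delta} \quad\text{with } \beta,\delta \in [-\pi,\pi].$$ One parametrizes $t = t_0(1+\tau)$ with $\tau = e^{i\alpha}u$, $u \in \mathbb{R}$, $\alpha\in[0,\pi)$; on this line $$f(t) - f(t_0) = -\frac{t_0^2}{2}\tau^2 + \frac{b}{4}\big(\tau - \log(1+\tau)\big).$$ The parameter $\kappa$ is given by $$\kappa = \begin{cases} 1 - \rho\,\dfrac{\sin^2\left(\frac{\beta}{2} - \frac{\delta}{4}\right)}{\cos\frac{\delta}{2}} & \text{if } \delta \in \left(-\frac{2\pi}{3}, \frac{2\pi}{3}\right),\\[1em] -\cos\left(\delta \pm \frac{\pi}{3}\right) - 2\rho\left(1 \mp \sin\left(\beta \pm \frac{\pi}{6}\right)\right) & \text{if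 } \delta \notin \left(-\frac{2\pi}{3}, \frac{2\pi}{3}\right),\end{cases}$$ where in the second case one may choose the upper or the lower signs as desired; if $\rho < 1/8$, one may instead choose $\kappa = 1/4$. A corresponding angle $\alpha\in[0,\pi)$ is one for which $$\sin\alpha \geq \tfrac12 \qquad\text{and}\qquad \mathrm{Re}\big(f(t) - f(t_0)\big) \leq -\kappa\,|d|\,|\tau|^2 \quad \text{for all } \tau = e^{i\alpha}u,\ u \in \mathbb{R},\ t = t_0(1+\tau).$$
   Formalization: In f the logarithm is continued along the shifted contour across the negative real axis into the adjacent quadrant instead of being principal; with the principal value of log t_0 the estimate fails, e.g. b=1, t_0=-1000e^{iε} (small ε>0), α=π/6, κ=1/4. *)

(* Defs.v *)
From mathcomp Require Import all_boot all_order all_algebra.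
From mathcomp Require Import all_classical all_reals all_analysis.
From mathcomp Require Export complex.
Export Normc.

Set Implicit Arguments.
Unset Strict Implicit.
Unset Printing Implicit Defensive.

Import Order.TTheory GRing.Theory Num.Theory.

Local Open Scope ring_scope.
Local Open Scope complex_scope.

Section ComplexFunctions.
Context {R : realType}.
Implicit Types (z t : R[i]) (x : R).

Definition cis x : R[i] := cos x +i* sin x.

Definition cexp z : R[i] := (expR (complex.Re z))%:C * cis (complex.Im z).

(* For z != 0 this is the argument in ]-pi, pi]. *)
Definition carg z : R :=
  let r := acos (complex.Re z / normc z) in
  if 0 <= complex.Im z then r else - r.

Definition clog z : R[i] := ln (normc z) +i* carg z.

Definition cintegral (g : R -> R[i]) : R[i] :=
  Rintegral lebesgue_measure setT (fun x => complex.Re (g x)) +i*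
  Rintegral lebesgue_measure setT (fun x => complex.Im (g x)).

End ComplexFunctions.

Section ParabolicCylinder.
Context {R : realType}.
Implicit Types (up : bool) (a b d z t : R[i]).

(* The sign +/- in U^+/- is encoded by a boolean: true for +, false for -. *)
Definition contour up (x : R) : R[i] := x +i* (if up then 1 else -1).

Definition pcf up a z : R[i] :=
  cexp (- (z ^+ 2 / 4)) *
  cintegral (fun x => let t := contour up x in
    cexp (z * t - t ^+ 2 / 2) * cexp ((a - 1 / 2) * clog t)).

(* The logarithm on the half-plane of [contour up], continued analytically
   across the negative real axis into the next quadrant, so that its cut is
   the imaginary half-axis on the other side of 0. It is [clog] except in that
   quadrant (and, for up = false, on the negative real axis, where its
   imaginary part is -pi). The line through t0, onto which
   the contour is moved, can cross the negative real axis before reaching t0;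
   the value of the phase function at t0 is the one continued along it. *)
Definition clog_cont up t : R[i] :=
  if up
  then clog t + (if (complex.Re t < 0) && (complex.Im t < 0)
                 then 0 +i* (2 * pi) else 0)
  else clog t - (if (complex.Re t < 0) && (0 <= complex.Im t)
                 then 0 +i* (2 * pi) else 0).

Lemma clog_cont_contour up x : clog_cont up (contour up x) = clog (contour up x).
Proof.
case: up; rewrite /clog_cont /contour /=.
- by rewrite ltr10 andbF addr0.
- by rewrite oppr_ge0 ler10 andbF subr0.
Qed.

Definition phase up b z t : R[i] :=
  z * t - t ^+ 2 / 2 - b / 4 * clog_cont up t.

Definition is_kappa (rho beta delta kappa : R) : Prop :=
  let inner := - (2 * pi / 3) < delta < 2 * pi / 3 in
  [\/ inner /\
        kappa = 1 - rho * (sin (beta / 2 - delta / 4) ^+ 2 / cos (delta / 2)),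
      ~ inner /\
        kappa = - cos (delta + pi / 3)
                - 2 * rho * (1 - sin (beta + pi / 6)),
      ~ inner /\
        kappa = - cos (delta - pi / 3)
                - 2 * rho * (1 + sin (beta - pi / 6))
    | rho < 1 / 8 /\ kappa = 1 / 4].

(* Whether the direction t0 * cis alpha of the line points to the left, in
   which case the line passes above 0. *)
Definition upper_side t0 (alpha : R) : bool := complex.Re (t0 * cis alpha) < 0.

Definition corresponding_angle b z t0 d (kappa alpha : R) : Prop :=
  1 / 2 <= sin alpha /\
  forall u : R,
    let f := phase (upper_side t0 alpha) b z in
    let tau := cis alpha * u%:C in
    let t := t0 * (1 + tau) in
    complex.Re (f t - f t0) <= - (kappa * normc d * normc tau ^+ 2).

(* [s] is the chosen square root of - 8 d - b. *)
Definition pcf_approx up b z t0 s : R[i] :=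
  cexp (- (z ^+ 2 / 4) + phase up b z t0) * t0 *
  ((2 * Num.sqrt (2 * pi))%:C / s).

End ParabolicCylinder.

(* Main.v *)
Require Import Defs.
From mathcomp Require Import all_boot all_order all_algebra.
From mathcomp Require Import all_classical all_reals all_analysis.
From mathcomp Require Import measurable_realfun ring lra.

(** The method is that of steepest descent along a straight line.  Write
    f for the phase.  As t0 is a critical point, z = t0 + b / (4 t0), and
    along the line t = t0 (1 + tau), tau = omega u with omega = +-cis alpha,
      f(t) - f(t0) = (d + b/8) tau^2 + (b/4) Q(u),
      Q(u) = tau - tau^2/2 - log (1 + tau).
    Since |1 + tau| >= sin alpha >= 1/2 on the line, the derivative
    - omega tau^2 / (1 + tau) of Q is at most 2 u^2, so Q is of cubic size.

    The descent inequality Re (f(t) - f(t0)) <= - k u^2, with k = kappa |d|,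
    carries two asymptotic facts.  Near u = 0 it gives Re w >= k for
    w = - (d + b/8) omega^2 (lemma [Re_w_ge]), so the Gaussian exp (- w u^2)
    obeys the same descent bound as the integrand.  For large u it gives
    Re (d omega^2) <= - k < 0 ([Re_d_le]), so the line meets the real axis
    at less than 45 degrees ([direction_slope]); there exp (- t^2/2) decays, and
    the horizontal contour can be moved onto the line ([contour_shift],
    [cintegral_line]).

    Then U is exp (- z^2/4 + f(t0)) t0 omega I with I the integral of
    exp (f(t) - f(t0)) over u, and the approximation is the same expression
    with I replaced by the Gaussian integral G = sqrt (2 pi) / V, V^2 = 2 w
    ([complex_gauss]); this is the choice s = 2 V / omega of the square root.
    From |exp x - exp y| <= |x - y| exp (max (Re x) (Re y)),
      |I - G| <= C |b| int |u|^3 exp (- k u^2) du = C |b| / k^2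
    ([gaussian_approx]), and dividing by |G| brings in |V|, which is
    sqrt |8 d + b| / 2.

    The contour is moved by differentiation under the integral sign: in a
    one-parameter family of lines, the derivative of the integral in the
    parameter is the integral of a total derivative in the variable of
    integration, hence zero. *)

Import Order.TTheory GRing.Theory Num.Theory.
Import numFieldNormedType.Exports.
Local Open Scope ring_scope.
Local Open Scope complex_scope.

Set Implicit Arguments.
Unset Strict Implicit.
Unset Printing Implicit Defensive.

Local Notation Re := (@complex.Re _).
Local Notation Im := (@complex.Im _).

(** * Real and imaginary parts, norm and exponential of complex numbers *)

Section ComplexBasics.
Context {R : realType}.
Implicit Types (z w t : R[i]) (x y : R).

Lemma complexP z w : Re z = Re w -> Im z = Im w -> z = w.
Proof. by case: z => a b; case: w => c d /= -> ->. Qed.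

Lemma Re_mul z w : Re (z * w) = Re z * Re w - Im z * Im w.
Proof. by case: z; case: w. Qed.

Lemma Im_mul z w : Im (z * w) = Re z * Im w + Im z * Re w.
Proof. by case: z; case: w. Qed.

Lemma Re_add z w : Re (z + w) = Re z + Re w.
Proof. by case: z; case: w. Qed.

Lemma Im_add z w : Im (z + w) = Im z + Im w.
Proof. by case: z; case: w. Qed.

Lemma Re_opp z : Re (- z) = - Re z.
Proof. by case: z. Qed.

Lemma Im_opp z : Im (- z) = - Im z.
Proof. by case: z. Qed.

Lemma Re_inv z : Re z^-1 = Re z / normc z ^+ 2.
Proof.
case: z => a b; rewrite /GRing.inv /= sqr_sqrtr //.
by rewrite addr_ge0 ?sqr_ge0.
Qed.

Lemma Im_inv z : Im z^-1 = - Im z / normc z ^+ 2.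
Proof.
case: z => a b; rewrite /GRing.inv /= sqr_sqrtr //.
  by rewrite mulNr.
by rewrite addr_ge0 ?sqr_ge0.
Qed.

Definition ReImE := (Re_mul, Im_mul, Re_add, Im_add, Re_opp, Im_opp).

Lemma sqr_normcE z : normc z ^+ 2 = Re z ^+ 2 + Im z ^+ 2.
Proof. by case: z => a b /=; rewrite sqr_sqrtr // addr_ge0 ?sqr_ge0. Qed.

Lemma normc_ge0 z : 0 <= normc z.
Proof. by case: z => a b /=; rewrite sqrtr_ge0. Qed.

Lemma normc_gt0 z : (0 < normc z) = (z != 0).
Proof.
rewrite lt0r normc_ge0 andbT; congr (~~ _).
by apply/eqP/eqP => [/eq0_normc //|->]; rewrite normc0.
Qed.

Lemma normc_Re z : `|Re z| <= normc z.
Proof.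
rewrite -(ler_pXn2r (n := 2)) ?nnegrE ?normc_ge0 //.
by rewrite sqr_normcE real_normK ?num_real // lerDl sqr_ge0.
Qed.

Lemma normc_Im z : `|Im z| <= normc z.
Proof.
rewrite -(ler_pXn2r (n := 2)) ?nnegrE ?normc_ge0 //.
by rewrite sqr_normcE real_normK ?num_real // lerDr sqr_ge0.
Qed.

Lemma normc_le z : normc z <= `|Re z| + `|Im z|.
Proof.
rewrite -(ler_pXn2r (n := 2)) ?nnegrE ?normc_ge0 ?addr_ge0 //.
rewrite sqr_normcE sqrrD !real_normK ?num_real //.
by have := mulr_ge0 (normr_ge0 (Re z)) (normr_ge0 (Im z)); lra.
Qed.

Lemma normc_real x : normc x%:C = `|x|.
Proof. by rewrite /= expr0n addr0 sqrtr_sqr. Qed.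

Lemma normc_nat n : normc (n%:R : R[i]) = n%:R.
Proof. by rewrite normcMn normc1. Qed.

Lemma normcX z n : normc (z ^+ n) = normc z ^+ n.
Proof.
elim: n => [|n ih]; first by rewrite !expr0 normc1.
by rewrite !exprS normcM ih.
Qed.

Lemma normc_cis x : normc (cis x) = 1.
Proof. by rewrite /= cos2Dsin2 sqrtr1. Qed.

Lemma normc_cexp z : normc (cexp z) = expR (Re z).
Proof. by rewrite /cexp normcM normc_cis mulr1 normc_real ger0_norm ?expR_ge0. Qed.

Lemma cexpE z : cexp z = (expR (Re z) * cos (Im z)) +i* (expR (Re z) * sin (Im z)).
Proof. by apply: complexP; rewrite /cexp !ReImE /= ?mul0r ?subr0 ?addr0. Qed.

Lemma cexpD z w : cexp (z + w) = cexp z * cexp w.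
Proof.
apply: complexP; rewrite !cexpE !ReImE /= ?cosD ?sinD expRD; ring.
Qed.

Lemma cexp_neq0 z : cexp z != 0.
Proof. by rewrite -normc_gt0 normc_cexp expR_gt0. Qed.

End ComplexBasics.

(** * Complex-valued functions of a real variable *)

Section ComplexDerivative.
Context {R : realType}.
Implicit Types (f g : R -> R[i]) (x : R).

(** Holomorphic functions are only differentiated along curves, where the
    derivative can be taken componentwise. *)
Definition is_cderive f x (l : R[i]) :=
  is_derive x 1 (Re \o f) (Re l) /\ is_derive x 1 (Im \o f) (Im l).

Lemma is_cderive_eq f x l l' : is_cderive f x l -> l = l' -> is_cderive f x l'.
Proof. by move=> h <-. Qed.

Lemma is_cderive_cst (c : R[i]) x : is_cderive (fun=> c) x 0.
Proof. by split; exact: is_derive_cst. Qed.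

Lemma is_cderive_pair (f g : R -> R) x a b :
  is_derive x 1 f a -> is_derive x 1 g b ->
  is_cderive (fun u => f u +i* g u) x (a +i* b).
Proof. by []. Qed.

Lemma is_cderive_real (f : R -> R) x a :
  is_derive x 1 f a -> is_cderive (fun u => (f u)%:C) x a%:C.
Proof. by move=> h; apply: is_cderive_pair => //; exact: is_derive_cst. Qed.

Lemma is_cderiveD f g x a b : is_cderive f x a -> is_cderive g x b ->
  is_cderive (fun u => f u + g u) x (a + b).
Proof.
move=> [f1 f2] [g1 g2]; split.
  rewrite (_ : _ \o _ = (Re \o f) + (Re \o g)); first by rewrite Re_add; exact: is_deriveD.
  by apply/funext => u /=; rewrite Re_add.
rewrite (_ : _ \o _ = (Im \o f) + (Im \o g)); first by rewrite Im_add; exact: is_deriveD.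
by apply/funext => u /=; rewrite Im_add.
Qed.

Lemma is_cderiveN f x a : is_cderive f x a -> is_cderive (fun u => - f u) x (- a).
Proof.
move=> [f1 f2]; split.
  rewrite (_ : _ \o _ = - (Re \o f)); first by rewrite Re_opp; exact: is_deriveN.
  by apply/funext => u /=; rewrite Re_opp.
rewrite (_ : _ \o _ = - (Im \o f)); first by rewrite Im_opp; exact: is_deriveN.
by apply/funext => u /=; rewrite Im_opp.
Qed.

Lemma is_cderiveB f g x a b : is_cderive f x a -> is_cderive g x b ->
  is_cderive (fun u => f u - g u) x (a - b).
Proof. by move=> hf /is_cderiveN; exact: is_cderiveD. Qed.

Lemma is_cderiveM f g x a b : is_cderive f x a -> is_cderive g x b ->
  is_cderive (fun u => f u * g u) x (a * g x + f x * b).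
Proof.
move=> [f1 f2] [g1 g2]; split.
  rewrite (_ : _ \o _ = (Re \o f) * (Re \o g) - (Im \o f) * (Im \o g)); last first.
    by apply/funext => u /=; rewrite Re_mul.
  apply: (is_derive_eq (is_deriveB (is_deriveM f1 g1) (is_deriveM f2 g2))).
  by rewrite !ReImE /GRing.scale /=; ring.
rewrite (_ : _ \o _ = (Re \o f) * (Im \o g) + (Im \o f) * (Re \o g)); last first.
  by apply/funext => u /=; rewrite Im_mul.
apply: (is_derive_eq (is_deriveD (is_deriveM f1 g2) (is_deriveM f2 g1))).
by rewrite !ReImE /GRing.scale /=; ring.
Qed.

Lemma is_cderiveZ f x a (c : R[i]) : is_cderive f x a ->
  is_cderive (fun u => c * f u) x (c * a).
Proof.
move=> hf; apply: is_cderive_eq; first exact: (is_cderiveM (is_cderive_cst c x) hf).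
by rewrite mul0r add0r.
Qed.

Lemma is_cderive_exp f x l : is_cderive f x l ->
  is_cderive (cexp \o f) x (l * cexp (f x)).
Proof.
move=> [f1 f2]; split.
  rewrite (_ : _ \o _ = (expR \o (Re \o f)) * (cos \o (Im \o f))); last first.
    by apply/funext => u; rewrite /comp cexpE.
  apply: (is_derive_eq (is_deriveM (is_derive1_comp (is_derive_expR _) f1)
    (is_derive1_comp (is_derive_cos _) f2))).
  by rewrite cexpE ?(Re_mul, Im_mul) /GRing.scale /=; ring.
rewrite (_ : _ \o _ = (expR \o (Re \o f)) * (sin \o (Im \o f))); last first.
  by apply/funext => u; rewrite /comp cexpE.
apply: (is_derive_eq (is_deriveM (is_derive1_comp (is_derive_expR _) f1)
  (is_derive1_comp (is_derive_sin _) f2))).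
by rewrite cexpE ?(Re_mul, Im_mul) /GRing.scale /=; ring.
Qed.

End ComplexDerivative.

(** * The logarithm on the plane cut along an imaginary half-axis *)

Section SlitLogarithm.
Context {R : realType}.
Implicit Types (e x y : R) (t : R[i]).

(** The branch of the logarithm on the plane minus the half-axis
    - i e [0, +oo[, where e = 1 or -1.  If theta is the angle of t measured
    from the ray e i [0, +oo[, the half-angle formula expresses
    tan (theta / 2) through Re t / (|t| + e Im t): a single formula, smooth
    on the whole cut plane, which is the set where |t| + e Im t > 0. *)
Definition slitlog e t : R[i] :=
  ln (normc t) +i* (e * (pi / 2 - 2 * atan (Re t / (normc t + e * Im t)))).

Lemma slit_normc_gt0 e t : e ^+ 2 = 1 -> 0 < normc t + e * Im t -> 0 < normc t.
Proof.
move=> he h; rewrite normc_gt0; apply/eqP => t0.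
by move: h; rewrite t0 normc0 /= mulr0 addr0 ltxx.
Qed.

Lemma slit_plane_intro e t : e ^+ 2 = 1 -> Re t != 0 \/ 0 < e * Im t -> 0 < normc t + e * Im t.
Proof.
move=> he [h|h]; last by have := normc_ge0 t; lra.
have h2 : 0 < Re t ^+ 2 by rewrite exprn_even_gt0.
have h3 := sqr_normcE t.
have h4 : (e * Im t) ^+ 2 = Im t ^+ 2 by rewrite exprMn he mul1r.
have h5 := normc_ge0 t.
rewrite ltNge; apply/negP => h6; nra.
Qed.

Lemma is_cderive_slitlog e (g : R -> R[i]) x l : e ^+ 2 = 1 ->
  0 < normc (g x) + e * Im (g x) -> is_cderive g x l ->
  is_cderive (slitlog e \o g) x (l / g x).
Proof.
move=> he pos [g1 g2].
have r0 := slit_normc_gt0 he pos.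
have nE : @normc R \o g = (fun u => Num.sqrt u) \o ((Re \o g) ^+ 2 + (Im \o g) ^+ 2).
  apply/funext => u; rewrite /comp !fctE /=.
  by case: (g u).
have rE := sqr_normcE (g x).
have s0 : 0 < ((Re \o g) ^+ 2 + (Im \o g) ^+ 2) x.
  by rewrite /comp !fctE /= -[X in 0 < X]rE exprn_gt0.
have dn : is_derive x 1 (@normc R \o g)
    ((Re (g x) * Re l + Im (g x) * Im l) / normc (g x)).
  have dS : is_derive x 1 ((Re \o g) ^+ 2 + (Im \o g) ^+ 2)
      (2 * (Re (g x) * Re l + Im (g x) * Im l)).
    by apply: (is_derive_eq (is_deriveD (is_deriveX 2 g1) (is_deriveX 2 g2))); rewrite /GRing.scale /= expr1; ring.
  rewrite nE; apply: (is_derive_eq (is_derive1_comp (is_derive1_sqrt s0) dS)).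
  rewrite (_ : ((Re \o g) ^+ 2 + (Im \o g) ^+ 2) x = normc (g x) ^+ 2); last by rewrite rE.
  rewrite sqrtr_sqr ger0_norm ?ltW // /GRing.scale /=; field.
  by rewrite gt_eqF.
have dd : is_derive x 1 (fun u => normc (g u) + e * Im (g u))
   ((Re (g x) * Re l + Im (g x) * Im l) / normc (g x) + e * Im l).
  exact: (is_deriveD dn (is_deriveZ e g2)).
split.
  rewrite (_ : _ \o _ = (@ln R) \o (@normc R \o g)); last by [].
  apply: (is_derive_eq (is_derive1_comp (is_derive1_ln r0) dn)).
  rewrite /GRing.scale Re_mul Re_inv Im_inv /=; field.
  by rewrite gt_eqF.
pose q := (Re \o g) * (fun u => (normc (g u) + e * Im (g u))^-1).
rewrite (_ : _ \o _ = e *: (cst (pi / 2) - 2 *: (@atan R \o q))); last by [].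
have dq : is_derive x 1 q
   ((Re l * (normc (g x) + e * Im (g x)) - Re (g x) *
   ((Re (g x) * Re l + Im (g x) * Im l) / normc (g x) + e * Im l)) /
   (normc (g x) + e * Im (g x)) ^+ 2).
  have pos' : normc (g x) + e * Im (g x) != 0 by rewrite gt_eqF.
  apply: (is_derive_eq (is_deriveM g1 (is_deriveV (f := fun u => normc (g u) + e * Im (g u)) pos' dd))); rewrite /GRing.scale /=.
  field.
  by rewrite pos' gt_eqF.
have da := is_derive1_comp (is_derive1_atan (q x)) dq.
apply: (is_derive_eq (is_deriveZ e (is_deriveB (is_derive_cst _ x 1) (is_deriveZ 2 da)))).
rewrite Im_mul Re_inv Im_inv /GRing.scale /= /q !fctE.
set r := normc (g x) in rE r0 pos *.
set a := Re (g x) in rE *; set b := Im (g x) in rE pos *.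
have aE : a ^+ 2 = (r - e * b) * (r + e * b).
  rewrite (_ : _ * _ = r ^+ 2 - e ^+ 2 * b ^+ 2); last by ring.
  by rewrite rE he; ring.
have -> : 1 + (a * (r + e * b)^-1) ^+ 2 = 2 * r / (r + e * b).
  rewrite exprMn aE; field; exact: lt0r_neq0.
set c := Re l; set d := Im l.
set s := r + e * b.
have -> : c * s - a * ((a * c + b * d) / r + e * d) = s * e * (b * c - a * d) / r.
  apply: (mulIf (lt0r_neq0 r0)); rewrite mulrBl mulrAC.
  rewrite (_ : a * _ * r = a ^+ 2 * c + a * d * (b + e * r)); last first.
    by field; exact: lt0r_neq0.
  rewrite aE (_ : b + e * r = e * s); last by rewrite /s mulrDr mulrA -expr2 he; ring.
  by rewrite /s; field; exact: lt0r_neq0.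
rewrite (_ : e * _ = e ^+ 2 * ((a * d - b * c) / r ^+ 2)).
  by rewrite he; field; exact: lt0r_neq0.
by field; rewrite !lt0r_neq0.
Qed.

(** The angle p stands for the argument of the continued logarithm, up to
    sign.  Where p leaves [0, pi], acos (cos p) is its reflection in the
    nearer endpoint, and the signs of cos p and sin p tell which one. *)
Lemma acos_cos_argument (p : R) : - (pi / 2) < p < 3 * (pi / 2) ->
  [/\ 0 <= sin p -> acos (cos p) = p,
      sin p <= 0 -> cos p < 0 -> acos (cos p) = 2 * pi - p &
      sin p <= 0 -> 0 <= cos p -> acos (cos p) = - p].
Proof.
move=> /andP[p1 p2]; have pi0 := @pi_gt0 R.
have sinB : sin p = - sin (p - pi) by rewrite -[in LHS](subrK pi p) sinDpi.
have cosB : cos p = - cos (p - pi) by rewrite -[in LHS](subrK pi p) cosDpi.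
have sgt : 0 < p -> p < pi -> 0 < sin p.
  by move=> h1 h2; apply: sin_gt0_pi; rewrite h1.
split.
- move=> h; apply: cosK; rewrite in_itv /=; apply/andP; split; rewrite leNgt; apply/negP => hp.
    have : 0 < sin (- p) by apply: sin_gt0_pi; lra.
    by rewrite sinN; lra.
  have : 0 < sin (p - pi) by apply: sin_gt0_pi; lra.
  by lra.
- move=> h1 h2.
  have hp : pi <= p.
    rewrite leNgt; apply/negP => hp.
    have [p0|p0] := ltP 0 p; first by have := sgt p0 hp; lra.
    have : 0 < cos p by apply: cos_gt0_pihalf; lra.
    by lra.
  have -> : cos p = cos (2 * pi - p).
    by rewrite -cosN -(cosD2pi (- p)); congr cos; rewrite mulr2n; ring.
  by apply: cosK; rewrite in_itv /=; lra.
- move=> h1 h2.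
  have hp : p <= 0.
    rewrite leNgt; apply/negP => hp.
    have [p0|p0] := ltP p pi; first by have := sgt hp p0; lra.
    have : 0 < cos (p - pi) by apply: cos_gt0_pihalf; lra.
    by lra.
  by apply: cosKN; lra.
Qed.

Definition sgn_of_side (up : bool) : R := if up then 1 else -1.

Lemma sgn_of_side_sqr up : sgn_of_side up ^+ 2 = 1.
Proof. by case: up; rewrite /= ?sqrrN expr1n. Qed.

(** With p the angle pi / 2 - 2 atan (Re t / (|t| + e Im t)), the double-angle
    formulas give cos p = Re t / |t| and sin p = e Im t / |t|, so p is the
    argument of t or of its conjugate, in a range cut where the continued
    logarithm is cut. *)
Lemma clog_contE up t : 0 < normc t + sgn_of_side up * Im t ->
  clog_cont up t = slitlog (sgn_of_side up) t.
Proof.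
set e := sgn_of_side up => pos; have he : e ^+ 2 = 1 := sgn_of_side_sqr up.
have r0 := slit_normc_gt0 he pos.
rewrite /slitlog.
set w := Re t / (normc t + e * Im t).
set p := pi / 2 - 2 * atan w.
have [a1 a2] : - (pi / 2) < atan w /\ atan w < pi / 2.
  by split; [exact: atan_gtNpi2 | exact: atan_ltpi2].
have hp : - (pi / 2) < p < 3 * (pi / 2) by rewrite /p; lra.
have w1 : 1 + w ^+ 2 = 2 * normc t / (normc t + e * Im t).
  have -> : w ^+ 2 = (normc t - e * Im t) / (normc t + e * Im t).
    rewrite /w exprMn (_ : Re t ^+ 2 = (normc t - e * Im t) * (normc t + e * Im t)).
      by field; rewrite lt0r_neq0.
    rewrite (_ : _ * _ = normc t ^+ 2 - e ^+ 2 * Im t ^+ 2); last by ring.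
    by rewrite sqr_normcE he; ring.
  by field; rewrite lt0r_neq0.
have w0 : 0 < 1 + w ^+ 2 by have := sqr_ge0 w; lra.
have cA : cos (atan w) ^+ 2 = (1 + w ^+ 2)^-1.
  by rewrite cos_atan exprVn sqr_sqrtr // ltW.
have c0 : cos (atan w) != 0.
  by rewrite cos_atan invr_eq0 gt_eqF // sqrtr_gt0.
have sA : sin (atan w) = w * cos (atan w).
  by rewrite -[X in X * _]atanK /tan divfK.
have cp : cos p = Re t / normc t.
  rewrite /p -opprB cosN cosBpihalf [2 * _]mulr_natl mulr2n sinD sA.
  rewrite (_ : _ + _ = 2 * w * cos (atan w) ^+ 2); last by ring.
  by rewrite cA w1 /w; field; rewrite !lt0r_neq0.
have sp : sin p = e * Im t / normc t.
  rewrite /p -opprB sinN sinBpihalf opprK [2 * _]mulr_natl mulr2n cosD sA.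
  rewrite (_ : _ - _ = (2 - (1 + w ^+ 2)) * cos (atan w) ^+ 2); last by ring.
  by rewrite cA w1 /w; field; rewrite !lt0r_neq0.
have [c1 c2 c3] := acos_cos_argument hp.
have xE : (Re t < 0) = (cos p < 0) by rewrite cp pmulr_llt0 ?invr_gt0.
have xE' : (0 <= Re t) = (0 <= cos p) by rewrite leNgt xE -leNgt.
have vE : (0 <= e * Im t) = (0 <= sin p) by rewrite sp [in RHS]pmulr_lge0 ?invr_gt0.
have vE' : (e * Im t <= 0) = (sin p <= 0) by rewrite sp [in RHS]pmulr_lle0 ?invr_gt0.
rewrite /clog_cont /clog /carg -cp.
clearbody p; clear he pos r0 w a1 a2 hp w1 w0 cA c0 sA cp sp.
rewrite {}/e in vE vE' *.
case: up vE vE' => /=; rewrite ?mul1r ?mulN1r => vE vE'; apply: complexP => /=.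
- by rewrite Re_add; case: (_ && _); rewrite /= addr0.
- rewrite Im_add /=; have [v0|v0] := leP 0 (Im t).
    by rewrite andbF addr0 c1 // -vE.
  have v0' : sin p <= 0 by rewrite -vE' ltW.
  rewrite andbT; case: ltP => x0 /=.
    by rewrite c2 // -?xE //; ring.
  by rewrite c3 // -?xE' // opprK addr0.
- by rewrite Re_add Re_opp; case: (_ && _); rewrite /= subr0.
- rewrite Im_add Im_opp /=; have [v0|v0] := leP 0 (Im t).
    have v0' : sin p <= 0 by rewrite -vE' oppr_le0.
    rewrite andbT; case: ltP => x0 /=.
      by rewrite c2 // -?xE //; ring.
    by rewrite c3 // -?xE' // subr0.
  by rewrite andbF subr0 c1 // -vE oppr_ge0 ltW.
Qed.

End SlitLogarithm.

(** * Integrals over the real line of functions with Gaussian decay *)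

Section RealLineIntegrals.
Local Open Scope classical_set_scope.
Context {R : realType}.
Local Notation mu := (@lebesgue_measure R).
Implicit Types (f g h : R -> R) (p q c K x : R).

Lemma ge0_integral_affine f p q : 0 < q -> continuous f -> (forall x, 0 <= f x) ->
  (\int[mu]_x (f x)%:E = \int[mu]_x (f (p + q * x) * q)%:E)%E.
Proof.
move=> q0 cf f0.
pose F x := p + q * x.
have dF x : is_derive x 1 F q.
  rewrite (_ : F = cst p + q *: id); last by [].
  apply: (is_derive_eq (is_deriveD (is_derive_cst _ _ _) (is_deriveZ q (is_derive_id _ _)))).
  by rewrite /GRing.scale /= mulr1 add0r.
have F'E : derive1 F = cst q.
  by apply/funext => x; rewrite derive1E; case: (dF x).
have F1 : {homo F : x y / x < y} by move=> x y xy; rewrite /F ltrD2l ltr_pM2l.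
have F2 : continuous (derive1 F) by rewrite F'E => x; exact: cvg_cst.
have F3 : cvg (derive1 F x @[x --> -oo]) by rewrite F'E; exact: is_cvg_cst.
have F4 : cvg (derive1 F x @[x --> +oo]) by rewrite F'E; exact: is_cvg_cst.
have F5 x : derivable F x 1 by case: (dF x).
have F6 : F x @[x --> -oo] --> -oo.
  by apply: cvg_comp (@cvg_addrl_Ny R p); apply: gt0_cvgMrNy => //; exact: cvg_id.
have F7 : F x @[x --> +oo] --> +oo.
  by apply: cvg_comp (@cvg_addrl R p); apply: gt0_cvgMry => //; exact: cvg_id.
rewrite (increasing_ge0_integration_by_substitutionT F1 F2 F3 F4 F5 F6 F7 cf f0).
by rewrite F'E.
Qed.

Lemma continuous_affine p q : continuous (fun x : R => p + q * x).
Proof.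
move=> x; apply: cvgD; first exact: cvg_cst.
by apply: cvgM; [exact: cvg_cst|exact: cvg_id].
Qed.

Lemma continuous_measurable_real f : continuous f -> measurable_fun setT f.
Proof. exact: continuous_measurable_fun. Qed.

Lemma continuous_measurable_EFin f : continuous f -> measurable_fun setT (EFin \o f).
Proof. by move=> cf; apply/measurable_EFinP; exact: continuous_measurable_real. Qed.

Lemma integrable_affine f p q : 0 < q -> continuous f ->
  mu.-integrable setT (EFin \o f) ->
  mu.-integrable setT (EFin \o (fun x => f (p + q * x))).
Proof.
move=> q0 cf /integrableP[_ fi].
have cF : continuous (fun x => f (p + q * x)).
  by move=> x; apply: (continuous_comp (@continuous_affine p q x)); exact: cf.
apply/integrableP; split.
  exact: continuous_measurable_EFin.
have cn : continuous (fun x => `|f x|).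
  by move=> x; apply: (continuous_comp (cf x)); exact: norm_continuous.
have {}fi : (\int[mu]_x (`|f x|)%:E < +oo)%E := fi.
rewrite (ge0_integral_affine p q0 cn (fun x => normr_ge0 _)) in fi.
change (\int[mu]_x (`|f (p + q * x)|)%:E < +oo)%E.
rewrite ltey; apply/eqP => h; move: fi.
under eq_integral do rewrite EFinM muleC.
rewrite ge0_integralZl_EFin //; last first.
- exact: ltW.
- by apply/measurable_EFinP; apply: measurableT_comp => //; exact: continuous_measurable_real.
by rewrite h mulry gtr0_sg // mul1e ltxx.
Qed.

(** Change of variable is available for nonnegative functions; a signed
    function is split into its positive and negative parts. *)
Lemma Rintegral_affine f p q : 0 < q -> continuous f ->
  mu.-integrable setT (EFin \o f) ->
  \int[mu]_x f x = q * \int[mu]_x f (p + q * x).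
Proof.
move=> q0 cf fi; rewrite -RintegralZl //; last exact: integrable_affine.
congr fine; rewrite integralE [RHS]integralE.
have aux (g : R -> R) : continuous g -> (forall x, 0 <= g x) ->
  (\int[mu]_x (g x)%:E = \int[mu]_x (q * g (p + q * x))%:E)%E.
  move=> cg g0; rewrite (ge0_integral_affine p q0 cg g0).
  by apply: eq_integral => x _; rewrite mulrC.
have auxmax (g : R -> R) : continuous g ->
  (\int[mu]_x (Num.max (g x) 0)%:E =
   \int[mu]_x (q * Num.max (g (p + q * x)) 0)%:E)%E.
  move=> cg; apply: (aux (fun x => Num.max (g x) 0)) => x.
    by apply: (@continuous_max _ _ g (cst 0) x (cg x)); exact: cvg_cst.
  by rewrite le_max lexx orbT.
congr (_ - _)%E.
  transitivity (\int[mu]_x (Num.max (f x) 0)%:E)%E.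
    by apply: eq_integral => x _; rewrite funeposE -EFin_max.
  rewrite auxmax //.
  by apply: eq_integral => x _; rewrite funeposE -EFin_max maxr_pMr ?mulr0 // ltW.
transitivity (\int[mu]_x (Num.max (- f x) 0)%:E)%E.
  by apply: eq_integral => x _; rewrite funenegE -EFinN -EFin_max.
rewrite (auxmax (fun x => - f x)); last by move=> x; apply: continuousN; exact: cf.
by apply: eq_integral => x _; rewrite funenegE -EFinN -EFin_max maxr_pMr ?mulr0 ?mulrN // ltW.
Qed.

(** The Gaussian decay c absorbs any linear growth K in the exponent.  Both
    parameters are kept so that products of bounds remain bounds of the
    same shape, with K and c adding up; c = 0 expresses mere growth. *)
Definition envelope K c x := expR (K * (1 + `|x|) - c * x ^+ 2).

Lemma continuous_expR_comp (f : R -> R) : continuous f -> continuous (fun x => expR (f x)).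
Proof. by move=> cf x; apply: (continuous_comp (cf x)); exact: continuous_expR. Qed.

Lemma continuous_envelope K c : continuous (envelope K c).
Proof.
apply: continuous_expR_comp => x; apply: cvgB; apply: cvgM; try exact: cvg_cst.
  by apply: cvgD; [exact: cvg_cst | exact: norm_continuous].
exact: exprn_continuous.
Qed.

Lemma integrable_gauss c : 0 < c ->
  mu.-integrable setT (EFin \o (fun x => expR (- (c * x ^+ 2)))).
Proof.
move=> c0; have s0 : 0 < Num.sqrt c by rewrite sqrtr_gt0.
have := integrable_affine 0 s0 (@continuous_gauss_fun R) (integrableT_gauss).
congr (mu.-integrable setT (EFin \o _)); apply/funext => x.
by rewrite /gauss_fun add0r exprMn sqr_sqrtr // ltW.
Qed.

(** Completing the square, K |x| <= (c / 2) x^2 + K^2 / (2 c). *)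
Lemma integrable_envelope K c : 0 < c ->
  mu.-integrable setT (EFin \o envelope K c).
Proof.
move=> c0.
have c2 : 0 < c / 2 by rewrite divr_gt0.
apply: (@le_integrable _ _ _ mu setT _ _
  (EFin \o (fun x => expR (K + K ^+ 2 / (2 * c)) * expR (- (c / 2 * x ^+ 2))))) => //.
- by apply: continuous_measurable_EFin; exact: continuous_envelope.
- move=> x _ /=; rewrite lee_fin !ger0_norm ?mulr_ge0 ?expR_ge0 //.
  rewrite -expRD ler_expR mulrDr mulr1 -2!addrA lerD2l.
  have -> : x ^+ 2 = `|x| ^+ 2 by rewrite real_normK ?num_real.
  have := sqr_ge0 (c * `|x| - K); move: `|x| => y hy.
  rewrite -(ler_pM2l c0).
  rewrite (_ : c * (K ^+ 2 / (2 * c) + _) = K ^+ 2 / 2 - c ^+ 2 / 2 * y ^+ 2); first by nra.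
  by field; rewrite gt_eqF.
- under [X in _ (X : _ -> _)]eq_fun do rewrite /= EFinM.
  by apply: integrableZl => //; exact: integrable_gauss.
Qed.

Lemma integrable_le_envelope f K c : 0 < c -> continuous f ->
  (forall x, `|f x| <= envelope K c x) -> mu.-integrable setT (EFin \o f).
Proof.
move=> c0 cf fE; apply: (le_integrable _ _ _ (integrable_envelope K c0)) => //.
  exact: continuous_measurable_EFin.
by move=> x _ /=; rewrite lee_fin [leRHS]ger0_norm ?expR_ge0.
Qed.

Lemma is_derive_continuous f f' : (forall x : R, is_derive x 1 f (f' x)) -> continuous f.
Proof.
by move=> df x; apply: differentiable_continuous; apply/derivable1_diffP; case: (df x).
Qed.

Lemma is_derive_Rintegral (f f' : R -> R -> R) (a K c : R) : 0 < c ->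
  (forall s x : R, is_derive s (1 : R) (f^~ x) (f' s x)) ->
  (forall s, continuous (f s)) ->
  (forall s x, `|s - a| < 1 -> `|f s x| <= envelope K c x) ->
  (forall s x, `|s - a| < 1 -> `|f' s x| <= envelope K c x) ->
  is_derive a 1 (fun s => \int[mu]_x f s x) (\int[mu]_x f' a x).
Proof.
move=> c0 df cf fE f'E.
have pE s x : partial1of2 f s x = f' s x by rewrite partial1of2E; case: (df s x).
have Ia : `]a - 1, a + 1[%classic a by rewrite /= in_itv /=; lra.
have inI s : `]a - 1, a + 1[%classic s -> `|s - a| < 1.
  by rewrite /= in_itv /= ltr_norml; lra.
have h1 s : `]a - 1, a + 1[%classic s -> mu.-integrable setT (EFin \o f s).
  by move=> Is; apply: (integrable_le_envelope c0 (cf s)) => x; apply: fE; exact: inI.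
have h2 s x : `]a - 1, a + 1[%classic s -> setT x -> derivable (f ^~ x) s 1.
  by move=> _ _; case: (df s x).
have h3 x : 0 <= envelope K c x by exact: expR_ge0.
have h4 := integrable_envelope K c0.
have h5 s x : `]a - 1, a + 1[%classic s -> setT x -> `|partial1of2 f s x| <= envelope K c x.
  by move=> Is _; rewrite pE; apply: f'E; exact: inI.
apply: DeriveDef; first exact: (derivable_under_integral measurableT Ia h1 h2 h3 h4 h5).
rewrite -derive1E (differentiation_under_integral measurableT Ia h1 h2 h3 h4 h5).
by apply: eq_Rintegral => x _; rewrite -pE.
Qed.

(** Dominations that are uniform under small translations are what
    differentiation under the integral sign asks of translates. *)
Lemma envelope_shift K c x y : 0 <= K -> 0 <= c -> `|y| < 1 ->
  envelope K c (y + x) <= envelope (2 * K + 2 * c) c x.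
Proof.
move=> K0 c0 y1; rewrite ler_expR.
have h1 : K * (1 + `|y + x|) <= K * (2 + `|x|).
  by apply: ler_wpM2l => //; have := ler_normD y x; lra.
have h2 : c * (- (2 * y * x)) <= c * (2 * `|x|).
  apply: ler_wpM2l => //; apply: (le_trans (ler_norm _)).
  rewrite normrN !normrM ger0_norm // -mulrA ler_pM2l //.
  by rewrite ler_piMl // ltW.
have h3 : 0 <= c * y ^+ 2 by rewrite mulr_ge0 ?sqr_ge0.
have h4 : 0 <= K * `|x| by rewrite mulr_ge0.
by nra.
Qed.

(** The integral of h (x + s) does not depend on s; its derivative at s = 0
    is the integral of h'.  No boundary terms have to be evaluated. *)
Lemma Rintegral_derivative_eq0 (h h' : R -> R) K c : 0 < c -> 0 <= K ->
  (forall x, is_derive x 1 h (h' x)) ->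
  (forall x, `|h x| <= envelope K c x) ->
  (forall x, `|h' x| <= envelope K c x) ->
  \int[mu]_x h' x = 0.
Proof.
move=> c0 K0 dh hE h'E.
have ch := is_derive_continuous dh.
pose J s := \int[mu]_x h (s + 1 * x).
have JE : J = cst (\int[mu]_x h x).
  apply/funext => s; rewrite [RHS](Rintegral_affine s ltr01 ch) ?mul1r //.
  exact: (integrable_le_envelope c0 ch).
have dJ : is_derive (0 : R) (1 : R) J (\int[mu]_x h' (0 + 1 * x)).
  apply: (@is_derive_Rintegral (fun s x => h (s + 1 * x)) (fun s x => h' (s + 1 * x))
    0 (2 * K + 2 * c) c c0).
  - move=> s x; have dshift : is_derive s (1 : R) (fun u : R => u + 1 * x) 1.
      apply: (is_derive_eq (is_deriveD (is_derive_id s 1) (is_derive_cst (1 * x) s 1))).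
      by rewrite addr0.
    by apply: (is_derive_eq (is_derive1_comp (dh _) dshift)); rewrite mulr1.
  - by move=> s x; apply: (continuous_comp (@continuous_affine s 1 x)); exact: ch.
  - move=> s x; rewrite subr0 mul1r => s1.
    by apply: (le_trans (hE _)); apply: envelope_shift => //; exact: ltW.
  - move=> s x; rewrite subr0 mul1r => s1.
    by apply: (le_trans (h'E _)); apply: envelope_shift => //; exact: ltW.
have <- : \int[mu]_x h' (0 + 1 * x) = \int[mu]_x h' x.
  by apply: eq_Rintegral => x _; rewrite add0r mul1r.
have [_ <-] := dJ; rewrite JE.
by have [_ ->] := is_derive_cst (\int[mu]_x h x) (0 : R) (1 : R).
Qed.

(** An antiderivative of u^3 exp (- c u^2) is
    - (u^2 / (2 c) + 1 / (2 c^2)) exp (- c u^2), and the integrand is even. *)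
Lemma integral_cubic_gauss c : 0 < c ->
  mu.-integrable setT (EFin \o (fun u => `|u| ^+ 3 * expR (- (c * u ^+ 2)))) /\
  \int[mu]_u (`|u| ^+ 3 * expR (- (c * u ^+ 2))) = 1 / c ^+ 2.
Proof.
move=> c0; set f := fun u : R => _.
have c2 : 0 < c / 2 by rewrite divr_gt0.
have ce : continuous (fun x : R => expR (- (c * x ^+ 2))).
  apply: continuous_expR_comp => x; apply: cvgN.
  by apply: cvgM; [exact: cvg_cst | exact: exprn_continuous].
have cf : continuous f.
  move=> x; apply: cvgM; last exact: ce.
  exact: (continuous_comp (@norm_continuous _ R x) (@exprn_continuous R 3 _)).
have f0 x : 0 <= f x by rewrite mulr_ge0 ?exprn_ge0 ?expR_ge0.
pose F u := - (u ^+ 2 / (2 * c) + 1 / (2 * c ^+ 2)) * expR (- (c * u ^+ 2)).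
have dF x : is_derive x 1 F (x ^+ 3 * expR (- (c * x ^+ 2))).
  have d1 : is_derive x 1 (fun u : R => - (c * u ^+ 2)) (- (c * (2 * x))).
    apply: (is_derive_eq (is_deriveN (is_deriveZ c (is_deriveX 2 (is_derive_id x 1))))).
    by rewrite /GRing.scale /= expr1 mulr1.
  have d2 : is_derive x 1 (fun u : R => - (u ^+ 2 / (2 * c) + 1 / (2 * c ^+ 2))) (- (x / c)).
    have := is_deriveN (is_deriveD (is_deriveZ (2 * c)^-1 (is_deriveX 2 (is_derive_id x 1)))
      (is_derive_cst (1 / (2 * c ^+ 2)) x 1)).
    rewrite (_ : - _ = (fun u : R => - (u ^+ 2 / (2 * c) + 1 / (2 * c ^+ 2)))); last first.
      by apply/funext => u; congr (- (_ + _)); exact: mulrC.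
    move=> h; apply: (is_derive_eq h).
    by rewrite /GRing.scale /= expr1; field; rewrite gt_eqF.
  apply: (is_derive_eq (is_deriveM d2 (is_derive1_comp (is_derive_expR _) d1))).
  by rewrite /GRing.scale /=; field; rewrite gt_eqF.
have F0 : F 0 = - (1 / (2 * c ^+ 2)).
  by rewrite /F expr0n /= mul0r mulr0 oppr0 expR0 mulr1 add0r.
have hcvg : F x @[x --> +oo] --> 0.
  have c22 : 0 <= (c ^+ 2)^-1 by rewrite invr_ge0 exprn_ge0 ?ltW.
  apply: norm_cvg0.
  apply: (@squeeze_cvgr _ _ _ _ (cst 0) (fun x => (c ^+ 2)^-1 * expR (- (c / 2 * x ^+ 2)))).
  - apply: nearW => x; rewrite normr_ge0 /= /F normrM normrN.
    rewrite [X in _ * X]ger0_norm ?expR_ge0 // ger0_norm; last first.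
      have h1 : 0 <= 2 * c by rewrite mulr_ge0 // ltW.
      have h2 : 0 <= 2 * c ^+ 2 by rewrite mulr_ge0 // sqr_ge0.
      by apply: addr_ge0; apply: divr_ge0 => //; exact: sqr_ge0.
    (* With y = c x^2, (1 + y) exp (- y) <= 2 exp (- y / 2). *)
    rewrite (_ : c * x ^+ 2 = c / 2 * x ^+ 2 + c / 2 * x ^+ 2); last by field.
    rewrite opprD expRD mulrA; apply: ler_wpM2r; first exact: expR_ge0.
    rewrite (_ : _ + _ = (c ^+ 2)^-1 * ((c * x ^+ 2 + 1) / 2)); last by field; rewrite gt_eqF.
    rewrite -[leLHS]mulrA; apply: ler_piMr => //.
    rewrite expRN ler_pdivrMr ?expR_gt0 // mul1r.
    by have := expR_ge1Dx (c / 2 * x ^+ 2); nra.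
  - exact: cvg_cst.
  - rewrite -(mulr0 (c ^+ 2)^-1); apply: cvgM; first exact: cvg_cst.
    apply: (cvg_comp (fun x => c / 2 * x ^+ 2) (fun x => expR (- x)) _ (@cvgr_expR R)).
    by apply: gt0_cvgMry => //; exact: cvgr_expr2.
have half : (\int[mu]_(x in [set x | (0 <= x)%R]) (f x)%:E = (1 / (2 * c ^+ 2))%:E)%E.
  rewrite -set_itvcy (@ge0_continuous_FTC2y R f F 0 0) //.
  - by rewrite F0 -EFinB sub0r opprK.
  - exact: continuous_subspaceT.
  - apply: cvg_at_right_filter; exact: (is_derive_continuous dF).
  - move=> x; rewrite in_itv /= andbT => x0.
    by rewrite derive1E; case: (dF x) => _ ->; rewrite /f gtr0_norm.
have fE : (\int[mu]_x (f x)%:E = (1 / c ^+ 2)%:E)%E.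
  rewrite ge0_symfun_integralT // ?half; first by rewrite -EFinM; congr EFin; field; rewrite gt_eqF.
  by move=> x; rewrite /f /= normrN sqrrN.
split; last by rewrite /Rintegral fE.
apply/integrableP; split; first exact: continuous_measurable_EFin.
under eq_integral do rewrite /= ger0_norm //.
by rewrite fE ltry.
Qed.

End RealLineIntegrals.

(** * Decay of the integrand on lines close to the real direction *)

Section Contour.
Context {R : realType}.
Implicit Types (b z t : R[i]) (e x y m K c : R).

Lemma envelopeM K K' c c' x :
  envelope K c x * envelope K' c' x = envelope (K + K') (c + c') x.
Proof. by rewrite -expRD; congr expR; ring. Qed.

Lemma le_envelope K K' c x : K <= K' -> envelope K c x <= envelope K' c x.
Proof.
move=> KK; rewrite ler_expR lerD2r; exact: ler_wpM2r.
Qed.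

Lemma envelope_ge0 K c x : 0 <= envelope K c x.
Proof. exact: expR_ge0. Qed.

Lemma le_linear_envelope a K x : a <= K * (1 + `|x|) -> a <= envelope K 0 x.
Proof.
move=> h; apply: (le_trans h); rewrite /envelope mul0r subr0.
by have := expR_ge1Dx (K * (1 + `|x|)); lra.
Qed.

Definition slitphase e b z t : R[i] :=
  z * t - t ^+ 2 / 2 - b / 4 * slitlog e t.

Definition pcf_integrand e b z t : R[i] :=
  cexp (slitphase e b z t).

Definition phase_deriv b z t : R[i] := z - t - b / 4 / t.

Lemma is_cderive_pcf_integrand e b z (g : R -> R[i]) x l : e ^+ 2 = 1 ->
  0 < normc (g x) + e * Im (g x) -> is_cderive g x l ->
  is_cderive (pcf_integrand e b z \o g) x
    (l * phase_deriv b z (g x) * pcf_integrand e b z (g x)).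
Proof.
move=> he pos dg.
have dL := is_cderive_slitlog he pos dg.
have d1 := is_cderiveB (is_cderiveB (is_cderiveZ z dg)
  (is_cderiveZ (2^-1) (is_cderiveM dg dg))) (is_cderiveZ (b / 4) dL).
have g0 : g x != 0 by rewrite -normc_gt0; exact: slit_normc_gt0 pos.
have := is_cderive_exp d1.
rewrite (_ : cexp \o _ = pcf_integrand e b z \o g); last first.
  by apply/funext => u; rewrite /comp /pcf_integrand /slitphase; congr cexp; rewrite /= expr2; ring.
move=> h; apply: (is_cderive_eq h).
rewrite /pcf_integrand /slitphase (_ : z * g x - _ - _ = z * g x - g x ^+ 2 / 2 - b / 4 * slitlog e (g x)).
  by congr (_ * _); rewrite /phase_deriv; field.
by rewrite expr2; congr (_ - _ - _); ring.
Qed.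

(** The line x |-> x + i e (y + m x) crosses the imaginary axis at i e y; for
    y > 0 it avoids the cut of [slitlog e]. *)
Definition line_point e y m x : R[i] := x +i* (e * (y + m * x)).

Lemma line_point_slit e y m x : e ^+ 2 = 1 -> 0 < y ->
  0 < normc (line_point e y m x) + e * Im (line_point e y m x).
Proof.
move=> he y0; apply: slit_plane_intro => //=.
have [->|x0] := eqVneq x 0; [right | by left].
by rewrite mulr0 addr0 mulrA -expr2 he mul1r.
Qed.

(** The modulus of ln r is at most r + 1 / r, and that of the argument is at
    most 3 pi / 2 < 6. *)
Lemma slitlog_bound e t : e ^+ 2 = 1 -> 0 < normc t ->
  normc (slitlog e t) <= normc t + (normc t)^-1 + 6.
Proof.
move=> he r0; apply: (le_trans (normc_le _)).
rewrite [Re _]/= [Im _]/=.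
have e1 : `|e| = 1.
  by apply/eqP; rewrite -(eqrXn2 (n := 2)) // expr1n real_normK ?num_real // he.
have hpi : pi < 4 :> R by have := @pihalf_lt2 R; lra.
apply: lerD.
  have h1 : ln (normc t) < normc t := ln_sublinear r0.
  have h2 : ln ((normc t)^-1) < (normc t)^-1 by apply: ln_sublinear; rewrite invr_gt0.
  rewrite lnV ?posrE // in h2.
  have h3 : 0 < (normc t)^-1 by rewrite invr_gt0.
  by rewrite ler_norml; lra.
rewrite normrM e1 mul1r.
set w := Re t / _.
have a1 := atan_gtNpi2 w; have a2 := atan_ltpi2 w.
by rewrite ler_norml; lra.
Qed.

Lemma line_point_norm e y m x ylo yhi : e ^+ 2 = 1 -> 0 < ylo -> ylo <= y <= yhi ->
  `|m| <= 1 ->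
  ylo / 2 <= normc (line_point e y m x) <= yhi + 2 * `|x|.
Proof.
move=> he y0 /andP[y1 y2] m1.
have e1 : `|e| = 1.
  by apply/eqP; rewrite -(eqrXn2 (n := 2)) // expr1n real_normK ?num_real // he.
have mx : `|m * x| <= `|x| by rewrite normrM ler_piMl.
apply/andP; split.
  have h1 := normc_Re (line_point e y m x).
  have h2 := normc_Im (line_point e y m x).
  rewrite /= in h1 h2 *.
  rewrite normrM e1 mul1r in h2.
  have h3 := lerB_normD y (m * x).
  have h4 := ler_norm y.
  by lra.
apply: (le_trans (normc_le _)); rewrite /= normrM e1 mul1r.
have h3 := ler_normD y (m * x).
have h4 : `|y| = y by rewrite ger0_norm //; lra.
by lra.
Qed.

(** For |m| <= mx < 1, Re t^2 >= (1 - mx^2) x^2 up to terms linear in |x|,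
    while z t and the logarithm grow at most linearly because t stays at
    distance at least ylo / 2 from 0.  The bounds are uniform in the line,
    as the lines will vary in a family. *)
Lemma pcf_integrand_bound e b z ylo yhi mx : e ^+ 2 = 1 -> 0 < ylo ->
  0 <= mx < 1 ->
  exists K c, [/\ 0 <= K, 0 < c & forall y m x, ylo <= y <= yhi -> `|m| <= mx ->
    normc (pcf_integrand e b z (line_point e y m x)) <= envelope K c x /\
    normc (phase_deriv b z (line_point e y m x)) <= envelope K 0 x].
Proof.
move=> he ylo0 /andP[mx0 mx1].
have [yy|yy] := ltP yhi ylo.
  by exists 0, 1; split => // y m x /andP[h1 h2]; lra.
set Z := normc z; set B := normc b.
have Z0 : 0 <= Z := normc_ge0 z.
have B0 : 0 <= B := normc_ge0 b.
have yi0 : 0 < ylo^-1 by rewrite invr_gt0.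
(* K0 collects the three terms of the exponent, K1 bounds its derivative;
   2 + yhi comes from |t| <= yhi + 2 |x|. *)
pose K0 := Z * (2 + yhi) + B * (8 + yhi + 2 * ylo^-1) + (yhi + yhi ^+ 2).
pose K1 := Z + 2 + yhi + B * (2 * ylo^-1).
have K00 : 0 <= K0.
  rewrite /K0; apply: addr_ge0; [apply: addr_ge0; apply: mulr_ge0 => //; lra|nra].
have K10 : 0 <= K1.
  rewrite /K1; apply: addr_ge0; [lra|apply: mulr_ge0 => //; lra].
exists (K0 + K1), ((1 - mx ^+ 2) / 2); split; [lra|nra|].
move=> y m x hy hm.
have y0 : 0 < y by lra.
have m1 : `|m| <= 1 by lra.
set t := line_point e y m x.
have /andP[r1 r2] : ylo / 2 <= normc t <= yhi + 2 * `|x| by exact: line_point_norm.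
have r0 : 0 < normc t by lra.
have ri : (normc t)^-1 <= 2 * ylo^-1.
  by rewrite -[2]invrK -invfM lef_pV2 ?posrE ?mulr_gt0 ?invr_gt0 //; lra.
have x0 := normr_ge0 x.
have lin (a A : R) : 0 <= A -> a <= A -> a <= A * (1 + `|x|).
  by move=> A0 aA; rewrite mulrDr mulr1; have := mulr_ge0 A0 x0; lra.
have hr : normc t <= (2 + yhi) * (1 + `|x|) by nra.
split; last first.
  apply: (le_trans _ (le_envelope 0 x (_ : K1 <= _))); last by lra.
  apply: le_linear_envelope; rewrite /phase_deriv.
  apply: (le_trans (le_normcD _ _)); apply: (le_trans (lerD (le_normcD _ _) (lexx _))).
  rewrite !normcN !normcM !normcV.
  rewrite normc_nat.
  rewrite -/Z -/B.
  have h1 : B / 4 / normc t <= B * (2 * ylo^-1) * (1 + `|x|).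
    apply: lin; first by apply: mulr_ge0 => //; lra.
    rewrite -mulrA; apply: ler_wpM2l => //.
    by have : 0 < (normc t)^-1; [rewrite invr_gt0|lra].
  have h2 : Z <= Z * (1 + `|x|) by exact: lin.
  rewrite /K1; move: h1 h2 hr; set u := B * _; set v := _ / normc t; nra.
apply: (le_trans _ (le_envelope _ x (_ : K0 <= _))); last by lra.
rewrite /pcf_integrand /slitphase normc_cexp ler_expR !ReImE.
have h1 : Re z * Re t - Im z * Im t <= Z * (2 + yhi) * (1 + `|x|).
  rewrite -Re_mul; apply: (le_trans (ler_norm _)); apply: (le_trans (normc_Re _)).
  by rewrite normcM -mulrA; apply: ler_wpM2l.
have h2 : - Re (b / 4 * slitlog e t) <= B * (8 + yhi + 2 * ylo^-1) * (1 + `|x|).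
  rewrite -Re_opp; apply: (le_trans (ler_norm _)); apply: (le_trans (normc_Re _)).
  rewrite normcN !normcM normcV.
  rewrite normc_nat.
  rewrite -/B -2!mulrA; apply: ler_wpM2l => //.
  have hl := slitlog_bound he r0.
  have h6 : 0 <= ylo^-1 * `|x| by apply: mulr_ge0 => //; lra.
  have h7 := normc_ge0 (slitlog e t).
  by rewrite -/t; nra.
have h3 : - Re (t ^+ 2 / 2) <= (yhi + yhi ^+ 2) * (1 + `|x|) - (1 - mx ^+ 2) / 2 * x ^+ 2.
  have -> : Re (t ^+ 2 / 2) = (x ^+ 2 - (y + m * x) ^+ 2) / 2.
    have -> : t ^+ 2 / 2 = (2^-1)%:C * (t * t).
      by rewrite rmorphV ?unitfE // rmorphMn mulrC expr2.
    rewrite !ReImE /= mul0r subr0 (_ : e * _ * (e * _) = e ^+ 2 * (y + m * x) ^+ 2); last by ring.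
    by rewrite he; field.
  have h4 : (y + m * x) ^+ 2 <= (yhi + mx * `|x|) ^+ 2.
    rewrite -[leLHS]real_normK ?num_real //.
    have h5 : `|y + m * x| <= yhi + mx * `|x|.
      apply: (le_trans (ler_normD _ _)); rewrite normrM.
      by apply: lerD; [rewrite ger0_norm; lra|apply: ler_wpM2r].
    by rewrite ler_pXn2r ?nnegrE //; nra.
  have h6 : x ^+ 2 = `|x| ^+ 2 by rewrite real_normK ?num_real.
  rewrite {}h6 in h4 *; move: h4; set X := `|x| in x0 *; set W := (y + m * x) ^+ 2 => h4.
  have h8 : 0 <= yhi by lra.
  have h9 : 0 <= yhi * X * (1 - mx) by rewrite !mulr_ge0 //; lra.
  have h10 : 0 <= yhi ^+ 2 * X by rewrite !mulr_ge0 // sqr_ge0.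
  have h11 := sqr_ge0 yhi.
  by nra.
move: h1 h2 h3; rewrite !ReImE /K0; lra.
Qed.

End Contour.

(** * Moving the contour *)

Section ContourShift.
Context {R : realType}.
Local Notation mu := (@lebesgue_measure R).
Implicit Types (b z t : R[i]) (e x y m K c : R).

(** If the derivative of P in the parameter is a total derivative of some B
    in the variable of integration, the integral of P is stationary. *)
Lemma cintegral_parameter_cst (P D B : R -> R -> R[i]) (P' : R -> R -> R[i]) K c :
  0 < c -> 0 <= K ->
  (forall s x, is_cderive (P^~ x) s (D s x)) ->
  (forall s x, is_cderive (P s) x (P' s x)) ->
  (forall s x, is_cderive (B s) x (D s x)) ->
  (forall s x, normc (P s x) <= envelope K c x) ->
  (forall s x, normc (B s x) <= envelope K c x) ->
  (forall s x, normc (D s x) <= envelope K c x) ->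
  forall s s', cintegral (P s) = cintegral (P s').
Proof.
move=> c0 K0 dP dPx dB hP hB hD s s'.
have aux (pr : R[i] -> R) :
  (forall w, `|pr w| <= normc w) ->
  (forall s x, is_derive s (1 : R) (pr \o P^~ x) (pr (D s x))) ->
  (forall s x, is_derive x (1 : R) (pr \o P s) (pr (P' s x))) ->
  (forall s x, is_derive x (1 : R) (pr \o B s) (pr (D s x))) ->
  \int[mu]_x pr (P s x) = \int[mu]_x pr (P s' x).
  move=> hpr d1 d2 d3.
  apply: (@is_derive_0_is_cst R (fun s => \int[mu]_x pr (P s x)) s s') => u.
  rewrite -(@Rintegral_derivative_eq0 R (pr \o B u) (fun x => pr (D u x)) K c) //.
  - apply: (@is_derive_Rintegral R (fun s x => pr (P s x)) (fun s x => pr (D s x)) u K c) => //.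
    + by move=> v; apply: (is_derive_continuous (d2 v)).
    + by move=> v x _; apply: (le_trans (hpr _)).
    + by move=> v x _; apply: (le_trans (hpr _)).
  - by move=> x; apply: (le_trans (hpr _)).
  - by move=> x; apply: (le_trans (hpr _)).
apply: complexP => /=; apply: aux.
- exact: normc_Re.
- by move=> v x; case: (dP v x).
- by move=> v x; case: (dPx v x).
- by move=> v x; case: (dB v x).
- exact: normc_Im.
- by move=> v x; case: (dP v x).
- by move=> v x; case: (dPx v x).
- by move=> v x; case: (dB v x).
Qed.

(** Cauchy's theorem for a family of lines.  For the points G s x of any family of
    curves, the s-derivative of F(G) dG/dx and the x-derivative of F(G) dG/ds
    are the same mixed expression D.  The lines are interpolated with weight
    sin^2 s, so that the parameter s ranges over the whole real line while
    intercepts and slopes remain in compact intervals. *)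
Lemma contour_shift e b z y0 m : e ^+ 2 = 1 -> 0 < y0 -> `|m| < 1 ->
  cintegral (fun x => pcf_integrand e b z (x +i* e)) =
  cintegral (fun x => pcf_integrand e b z (line_point e y0 m x) * (1 +i* (e * m))).
Proof.
move=> he y00 m1.
have e1 : `|e| = 1.
  by apply/eqP; rewrite -(eqrXn2 (n := 2)) // expr1n real_normK ?num_real // he.
pose sg s : R := sin s ^+ 2.
pose sg' s : R := 2 * sin s * cos s.
have sg01 s : 0 <= sg s <= 1.
  rewrite /sg sqr_ge0 /=; have := cos2Dsin2 s; have := sqr_ge0 (cos s); lra.
have sg'1 s : `|sg' s| <= 2.
  rewrite ler_norml /sg'; have := cos2Dsin2 s.
  have := sqr_ge0 (cos s + sin s); have := sqr_ge0 (cos s - sin s); nra.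
have dsg s : is_derive s (1 : R) sg (sg' s).
  apply: (is_derive_eq (is_deriveX 2 (is_derive_sin s))).
  by rewrite /GRing.scale /= expr1.
pose Y s := 1 + sg s * (y0 - 1).
pose M s := sg s * m.
pose ylo := Num.min 1 y0; pose yhi := Num.max 1 y0.
have ylo0 : 0 < ylo by rewrite lt_min ltr01.
have hY s : ylo <= Y s <= yhi.
  have /andP[a1 a2] := sg01 s.
  rewrite /Y /ylo /yhi ge_min le_max.
  by case: (lerP 1 y0) => h; apply/andP; split; apply/orP; [left|right|right|left]; nra.
have hM s : `|M s| <= `|m|.
  have /andP[a1 a2] := sg01 s.
  by rewrite normrM ger0_norm // ler_piMl.
have hM1 s : `|M s| <= 1 by apply: (le_trans (hM s)); exact: ltW.
have m01 : 0 <= `|m| < 1 by rewrite normr_ge0.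
have [K [c [K0 c0 bnd]]] := pcf_integrand_bound b z yhi he ylo0 m01.
pose F := pcf_integrand e b z.
pose G s x := line_point e (Y s) (M s) x.
have slit s x : 0 < normc (G s x) + e * Im (G s x).
  by apply: line_point_slit => //; have /andP[h _] := hY s; exact: lt_le_trans h.
have dGs s x : is_cderive (G^~ x) s (0 +i* (e * (sg' s * (y0 - 1 + m * x)))).
  apply: (is_cderive_pair (is_derive_cst x s 1)).
  have h := is_deriveZ e (is_deriveD (is_derive_cst (1 : R) s 1)
    (is_deriveZ (y0 - 1 + m * x) (dsg s))).
  rewrite (_ : (fun _ => _) = e *: (cst 1 + (y0 - 1 + m * x) *: sg)); last first.
    by apply/funext => u; rewrite /Y /M !fctE /GRing.scale /=; ring.
  by apply: (is_derive_eq h); rewrite /GRing.scale /=; ring.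
have dGx s x : is_cderive (G s) x (1 +i* (e * M s)).
  apply: (is_cderive_pair (is_derive_id x (1 : R))).
  have h := is_deriveZ e (is_deriveD (is_derive_cst (Y s) x 1)
    (is_deriveZ (M s) (is_derive_id x (1 : R)))).
  by apply: (is_derive_eq h); rewrite /GRing.scale /=; ring.
pose P s x := F (G s x) * (1 +i* (e * M s)).
pose V s x : R[i] := 0 +i* (e * (sg' s * (y0 - 1 + m * x))).
pose B s x := F (G s x) * V s x.
pose N s : R[i] := 0 +i* (e * (sg' s * m)).
pose D s x := V s x * phase_deriv b z (G s x) * F (G s x) * (1 +i* (e * M s))
   + F (G s x) * N s.
have dFs s x := is_cderive_pcf_integrand (g := G^~ x) b z he (slit s x) (dGs s x).
have dFx s x := is_cderive_pcf_integrand (g := G s) b z he (slit s x) (dGx s x).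
have dP s x : is_cderive (P^~ x) s (D s x).
  have h : is_cderive (fun s => 1 +i* (e * M s)) s (N s).
    apply: (is_cderive_pair (is_derive_cst (1 : R) s (1 : R))).
    have h := is_deriveZ e (is_deriveZ m (dsg s)).
    rewrite (_ : (fun _ => _) = e *: (m *: sg)); last first.
      by apply/funext => u; rewrite /M !fctE /GRing.scale /=; ring.
    by apply: (is_derive_eq h); rewrite /GRing.scale /=; ring.
  exact: (is_cderiveM (dFs s x) h).
have dPx s x := is_cderiveM (dFx s x) (is_cderive_cst (1 +i* (e * M s)) x).
have dB s x : is_cderive (B s) x (D s x).
  have h : is_cderive (V s) x (N s).
    apply: (is_cderive_pair (is_derive_cst (0 : R) x (1 : R))).
    have h := is_deriveZ e (is_deriveZ (sg' s) (is_deriveD (is_derive_cst (y0 - 1) x 1)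
      (is_deriveZ m (is_derive_id x (1 : R))))).
    by apply: (is_derive_eq h); rewrite /GRing.scale /=; ring.
  apply: (is_cderive_eq (is_cderiveM (dFx s x) h)).
  by rewrite /D /V; congr (_ + _); rewrite /F; ring.
(* K2 dominates the velocities of the family: those in s carry the factor
   |sg'| <= 2 and an ordinate y0 - 1 + m x with |m| < 1. *)
pose K2 := 2 * (y0 + 2).
have hF s x : normc (F (G s x)) <= envelope K c x by case: (bnd _ _ x (hY s) (hM s)).
have hd s x : normc (phase_deriv b z (G s x)) <= envelope K 0 x.
  by case: (bnd _ _ x (hY s) (hM s)).
have hV s x : normc (V s x) <= envelope K2 0 x.
  apply: le_linear_envelope; apply: (le_trans (normc_le _)).
  rewrite /= normr0 add0r normrM e1 mul1r normrM.
  have h1 : `|y0 - 1 + m * x| <= (y0 + 2) * (1 + `|x|).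
    have h2 : `|m * x| <= `|x| by rewrite normrM ler_piMl // ltW.
    have h3 := ler_normD (y0 - 1) (m * x).
    have h4 : `|y0 - 1| <= y0 + 1 by rewrite ler_norml; lra.
    have := normr_ge0 x; nra.
  by rewrite /K2 -mulrA; apply: ler_pM.
have hN s x : normc (N s) <= envelope K2 0 x.
  apply: le_linear_envelope; apply: (le_trans (normc_le _)).
  rewrite /= normr0 add0r normrM e1 mul1r normrM.
  have := sg'1 s; have := normr_ge0 (sg' s); have := normr_ge0 m; have := normr_ge0 x.
  by rewrite /K2; nra.
have hU s x : normc (1 +i* (e * M s)) <= envelope K2 0 x.
  apply: le_linear_envelope; apply: (le_trans (normc_le _)).
  rewrite [Re _]/= [Im _]/= normr1 normrM e1 mul1r.
  by have := hM1 s; have := normr_ge0 x; rewrite /K2; nra.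
have K20 : 0 <= K2 by rewrite /K2; lra.
pose KK := 2 * K + 2 * K2 + 1.
have nM (u v : R[i]) a a' : normc u <= a -> normc v <= a' -> normc (u * v) <= a * a'.
  by move=> h1 h2; rewrite normcM; apply: ler_pM => //; exact: normc_ge0.
have hP s x : normc (P s x) <= envelope KK c x.
  apply: (le_trans (nM _ _ _ _ (hF s x) (hU s x))).
  by rewrite envelopeM addr0; apply: le_envelope; rewrite /KK; lra.
have hB s x : normc (B s x) <= envelope KK c x.
  apply: (le_trans (nM _ _ _ _ (hF s x) (hV s x))).
  by rewrite envelopeM addr0; apply: le_envelope; rewrite /KK; lra.
have hD s x : normc (D s x) <= envelope KK c x.
  apply: (le_trans (le_normcD _ _)).
  apply: (le_trans (lerD
    (nM _ _ _ _ (nM _ _ _ _ (nM _ _ _ _ (hV s x) (hd s x)) (hF s x)) (hU s x))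
    (nM _ _ _ _ (hF s x) (hN s x)))).
  rewrite !envelopeM !add0r !addr0.
  have h1 : envelope (K2 + K + K + K2) c x <= envelope (2 * K + 2 * K2) c x.
    by apply: le_envelope; lra.
  have h2 : envelope (K + K2) c x <= envelope (2 * K + 2 * K2) c x.
    by apply: le_envelope; lra.
  apply: (le_trans (lerD h1 h2)).
  rewrite [leRHS](_ : _ = envelope (2 * K + 2 * K2) c x * envelope 1 0 x); last first.
    by rewrite envelopeM addr0.
  rewrite [leLHS](_ : _ = envelope (2 * K + 2 * K2) c x * 2); last by ring.
  apply: ler_wpM2l; first exact: envelope_ge0.
  rewrite /envelope mul0r subr0 mul1r.
  by have := expR_ge1Dx (1 + `|x|); have := normr_ge0 x; lra.
have KK0 : 0 <= KK by rewrite /KK; lra.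
have := cintegral_parameter_cst c0 KK0 dP dPx dB hP hB hD 0 (pi / 2).
rewrite (_ : P 0 = fun x => F (x +i* e)); last first.
  apply/funext => x; rewrite /P /G /Y /M /sg sin0 expr0n /= !mul0r mulr0 addr0 mulr1.
  by congr (F _); rewrite /line_point mul0r addr0 mulr1.
rewrite (_ : P (pi / 2) = fun x => F (line_point e y0 m x) * (1 +i* (e * m))) //.
apply/funext => x; rewrite /P /G /Y /M /sg sin_pihalf expr1n !mul1r.
by rewrite addrC subrK.
Qed.

End ContourShift.

(** * Integrals of complex-valued functions, and the complex Gaussian *)

Section ComplexIntegral.
Context {R : realType}.
Local Notation mu := (@lebesgue_measure R).
Implicit Types (g : R -> R[i]) (c : R[i]).

(** Regularity and decay sufficient for each integral in sight to exist and
    to be transformed by linearity and by affine changes of variable. *)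
Definition tame g :=
  (exists g', forall x, is_cderive g x (g' x)) /\
  (exists K k : R, 0 < k /\ forall x, normc (g x) <= envelope K k x).

Lemma tame_continuous_Re g : tame g -> continuous (Re \o g).
Proof. by move=> [[g' dg] _]; apply: is_derive_continuous => x; case: (dg x). Qed.

Lemma tame_continuous_Im g : tame g -> continuous (Im \o g).
Proof. by move=> [[g' dg] _]; apply: is_derive_continuous => x; case: (dg x). Qed.

Lemma tame_integrable_Re g : tame g -> mu.-integrable setT (EFin \o (fun x => Re (g x))).
Proof.
move=> tg; have [_ [K [c [c0 gE]]]] := tg.
apply: (integrable_le_envelope c0 (tame_continuous_Re tg)) => x.
exact: le_trans (normc_Re _) (gE x).
Qed.

Lemma tame_integrable_Im g : tame g -> mu.-integrable setT (EFin \o (fun x => Im (g x))).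
Proof.
move=> tg; have [_ [K [c [c0 gE]]]] := tg.
apply: (integrable_le_envelope c0 (tame_continuous_Im tg)) => x.
exact: le_trans (normc_Im _) (gE x).
Qed.

Lemma cintegralZ g c : tame g -> cintegral (fun x => c * g x) = c * cintegral g.
Proof.
move=> tg; have iR := tame_integrable_Re tg; have iI := tame_integrable_Im tg.
have sc (r : R) (f : R -> R) : mu.-integrable setT (EFin \o f) ->
    mu.-integrable setT (EFin \o (fun x => r * f x)).
  by move=> fi; apply: (integrableZl measurableT r fi).
apply: complexP; rewrite ?(Re_mul, Im_mul) /=.
  under eq_Rintegral do rewrite Re_mul.
  by rewrite RintegralB // ?RintegralZl //; exact: sc.
under eq_Rintegral do rewrite Im_mul.
by rewrite RintegralD // ?RintegralZl //; exact: sc.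
Qed.

Lemma cintegral_affine g (p q : R) : 0 < q -> tame g ->
  cintegral g = q%:C * cintegral (fun x => g (p + q * x)).
Proof.
move=> q0 tg; apply: complexP; rewrite ?(Re_mul, Im_mul) /= !mul0r ?subr0 ?addr0.
  exact: (Rintegral_affine p q0 (tame_continuous_Re tg) (tame_integrable_Re tg)).
exact: (Rintegral_affine p q0 (tame_continuous_Im tg) (tame_integrable_Im tg)).
Qed.

Lemma normc_cintegralB g1 g2 (h : R -> R) : tame g1 -> tame g2 ->
  mu.-integrable setT (EFin \o h) ->
  (forall x, `|Re (g1 x) - Re (g2 x)| <= h x) ->
  (forall x, `|Im (g1 x) - Im (g2 x)| <= h x) ->
  normc (cintegral g1 - cintegral g2) <= 2 * \int[mu]_x h x.
Proof.
move=> t1 t2 ih hR hI; apply: (le_trans (normc_le _)).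
rewrite !ReImE mulr_natl mulr2n /=.
have aux (f1 f2 : R -> R) : mu.-integrable setT (EFin \o f1) ->
    mu.-integrable setT (EFin \o f2) -> (forall x, `|f1 x - f2 x| <= h x) ->
    `|\int[mu]_x f1 x - \int[mu]_x f2 x| <= \int[mu]_x h x.
  move=> i1 i2 hh; rewrite -RintegralB //.
  have ib : mu.-integrable setT (EFin \o (fun x => f1 x - f2 x)).
    exact: (integrableB measurableT i1 i2).
  apply: (le_trans (le_normr_Rintegral _ ib)) => //.
  apply: le_Rintegral => //; exact: (integrable_norm ib).
apply: lerD; apply: aux => //.
- exact: tame_integrable_Re.
- exact: tame_integrable_Re.
- exact: tame_integrable_Im.
- exact: tame_integrable_Im.
Qed.

Lemma is_cderive_idC (x : R) : is_cderive (fun u : R => u%:C) x 1.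
Proof. by apply: is_cderive_real; exact: is_derive_id. Qed.

Lemma tame_gauss c : 0 < Re c -> tame (fun u => cexp (- (c * u%:C ^+ 2))).
Proof.
move=> c0; split.
  exists (fun u => - (c * (1 * u%:C + u%:C * 1)) * cexp (- (c * u%:C ^+ 2))) => x.
  exact: (is_cderive_exp (is_cderiveN (is_cderiveZ c
    (is_cderiveM (is_cderive_idC x) (is_cderive_idC x))))).
exists 0, (Re c); split => // x.
rewrite normc_cexp /envelope mul0r sub0r Re_opp Re_mul.
by rewrite -rmorphXn /= mulr0 subr0.
Qed.

Lemma Rintegral_gauss : \int[mu]_x expR (- (x ^+ 2 / 2)) = Num.sqrt (2 * pi) :> R.
Proof.
have q0 : 0 < (Num.sqrt 2)^-1 :> R by rewrite invr_gt0 sqrtr_gt0.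
have h := Rintegral_affine 0 q0 (@continuous_gauss_fun R) (@integrableT_gauss R).
have h2 : \int[mu]_x gauss_fun x = Num.sqrt pi :> R.
  by rewrite /Rintegral integralT_gauss.
rewrite h2 in h; rewrite sqrtrM // h mulrA mulfV ?mul1r; last first.
  by rewrite gt_eqF // sqrtr_gt0.
apply: eq_Rintegral => x _; rewrite /gauss_fun add0r exprMn exprVn sqr_sqrtr //.
by congr expR; ring.
Qed.

(** The Gaussian of real variance is rotated to direction V by moving its
    contour.  Taking b = 0 and z = i, the integrand is a Gaussian centred at
    i, and the lines through i stay away from the cut. *)
Lemma complex_gauss (V : R[i]) : `|Im V| < Re V ->
  V * cintegral (fun u => cexp (- (V ^+ 2 / 2 * u%:C ^+ 2))) = (Num.sqrt (2 * pi))%:C.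
Proof.
move=> hV; have r0 : 0 < Re V by apply: le_lt_trans hV.
(* v = V / Re V is the direction with abscissa 1; the length Re V is restored
   at the end by scaling u. *)
pose m := Im V / Re V; pose v : R[i] := 1 +i* m.
have m1 : `|m| < 1.
  by rewrite /m normrM normfV (gtr0_norm r0) ltr_pdivrMr // mul1r.
have VE : V = (Re V)%:C * v.
  by apply: complexP; rewrite !ReImE /= mul0r ?subr0 ?addr0 ?mulr1 // /m mulrC divfK // gt_eqF.
have v2 : 0 < Re (v ^+ 2 / 2).
  have -> : v ^+ 2 / 2 = (2^-1)%:C * (v * v).
    by rewrite rmorphV ?unitfE // rmorphMn mulrC expr2.
  rewrite !ReImE /= mul0r subr0; move: m1; rewrite ltr_norml => /andP[? ?]; nra.
have tv := tame_gauss v2.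
have one2 : 0 < Re (2^-1 : R[i]).
  by rewrite (_ : 2^-1 = (2^-1)%:C) /= ?invr_gt0 // rmorphV ?unitfE // rmorphMn.
have t1 := tame_gauss one2.
have := @contour_shift R 1 0 'i%C 1 m (expr1n _ _) ltr01 m1.
have pE (t : R[i]) : pcf_integrand 1 0 'i%C t = cexp (- 2^-1) * cexp (- (2^-1 * (t - 'i%C) ^+ 2)).
  rewrite /pcf_integrand /slitphase !mul0r subr0 -cexpD; congr cexp.
  have -> : (t - 'i%C) ^+ 2 = t ^+ 2 - 2 * 'i%C * t - 1.
    by rewrite sqrrB sqr_i; ring.
  by field.
have -> : (fun x : R => pcf_integrand 1 0 'i%C (x +i* 1)) =
    (fun x => cexp (- 2^-1) * cexp (- (2^-1 * x%:C ^+ 2))).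
  apply/funext => x; rewrite pE; congr (_ * cexp (- (_ * _ ^+ 2))).
  by apply: complexP; rewrite /= ?subr0 ?subrr.
have -> : (fun x : R => pcf_integrand 1 0 'i%C (line_point 1 1 m x) * (1 +i* (1 * m))) =
    (fun x => (cexp (- 2^-1) * v) * cexp (- (v ^+ 2 / 2 * x%:C ^+ 2))).
  apply/funext => x; rewrite pE mul1r -/v.
  rewrite (_ : line_point 1 1 m x - 'i%C = v * x%:C); last first.
    by apply: complexP; rewrite /v !ReImE /=; ring.
  by rewrite exprMn mulrAC; congr (_ * cexp (- _)); field.
rewrite !cintegralZ // -mulrA => /(mulfI (cexp_neq0 _)) H.
have hx (x : R) : cexp (- (2^-1 * x%:C ^+ 2)) = (expR (- (x ^+ 2 / 2)))%:C.
  rewrite (_ : - _ = (- (x ^+ 2 / 2))%:C).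
    by rewrite cexpE /= cos0 sin0 mulr1 mulr0.
  by rewrite rmorphN rmorphM rmorphXn rmorphV ?unitfE // rmorphMn mulrC.
rewrite -[RHS](_ : cintegral (fun x => cexp (- (2^-1 * x%:C ^+ 2))) = _); last first.
  under eq_fun do rewrite hx.
  apply: complexP => /=; first exact: Rintegral_gauss.
  by rewrite /Rintegral integral0.
rewrite H (cintegral_affine 0 r0 tv) {1}VE [RHS]mulrCA [RHS]mulrA.
congr (_ * cintegral _); apply/funext => u; congr (cexp (- _)).
by rewrite {1}VE add0r rmorphM; ring.
Qed.

End ComplexIntegral.

(** * Increments bounded through derivatives *)

Section GrowthBounds.
Context {R : realType}.

(** Both g - f and g + f have a nonnegative derivative. *)
Lemma derive_le_increment (f g f' g' : R -> R) (u v : R) : u <= v ->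
  (forall x, is_derive x (1 : R) f (f' x)) ->
  (forall x, is_derive x (1 : R) g (g' x)) ->
  (forall x, u < x < v -> `|f' x| <= g' x) ->
  `|f v - f u| <= g v - g u.
Proof.
rewrite le_eqVlt => /orP[/eqP ->|uv] df dg h; first by rewrite !subrr normr0.
have key (s : R) : `|s| = 1 -> s * (f v - f u) <= g v - g u.
  move=> s1.
  have dk x : is_derive x (1 : R) (g - s *: f) (g' x - s *: f' x).
    exact: (is_deriveB (dg x) (is_deriveZ s (df x))).
  have ck := is_derive_continuous dk.
  have [c cuv] := @MVT R (g - s *: f) (fun x => g' x - s *: f' x) u v uv
    (fun x _ => dk x) (continuous_subspaceT ck).
  have hc : 0 <= g' c - s * f' c.
    have hb : `|f' c| <= g' c by apply: h; move: cuv; rewrite in_itv.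
    have : s * f' c <= `|f' c| by apply: (le_trans (ler_norm _)); rewrite normrM s1 mul1r.
    by lra.
  rewrite !fctE /GRing.scale /= => E.
  have : 0 <= (g' c - s * f' c) * (v - u) by rewrite mulr_ge0 // subr_ge0 ltW.
  by rewrite -E; lra.
(* The absolute value is reached by testing against the signs 1 and -1. *)
have h1 := key 1 (normr1 _); have h2 := key (-1) (normrN1 _).
by rewrite ler_norml; lra.
Qed.

Lemma derive_le_cubic (f f' : R -> R) (C u : R) :
  (forall x, is_derive x (1 : R) f (f' x)) -> f 0 = 0 ->
  (forall x, `|f' x| <= 3 * C * x ^+ 2) -> `|f u| <= C * `|u| ^+ 3.
Proof.
move=> df f0 h.
have dg x : is_derive x (1 : R) (C *: (id ^+ 3)) (3 * C * x ^+ 2).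
  apply: (is_derive_eq (is_deriveZ C (is_deriveX 3 (is_derive_id x (1 : R))))).
  by rewrite /GRing.scale /=; ring.
have [u0|u0] := leP 0 u.
  have := derive_le_increment u0 df dg (fun x _ => h x).
  by rewrite f0 !fctE /GRing.scale /= subr0 expr0n /= mulr0 subr0 (ger0_norm u0).
have := derive_le_increment (ltW u0) df dg (fun x _ => h x).
rewrite f0 !fctE /GRing.scale /= sub0r expr0n /= mulr0 sub0r normrN => hu.
by rewrite (ltr0_norm u0) (_ : C * (- u) ^+ 3 = - (C * u ^+ 3)) //; ring.
Qed.

Lemma derive_le_linear (f f' : R -> R) (C u : R) :
  (forall x, is_derive x (1 : R) f (f' x)) -> f 0 = 0 ->
  (forall x, `|f' x| <= C) -> `|f u| <= C * `|u|.
Proof.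
move=> df f0 h.
have dg x : is_derive x (1 : R) (C *: id) C.
  apply: (is_derive_eq (is_deriveZ C (is_derive_id x (1 : R)))).
  by rewrite /GRing.scale /= mulr1.
have [u0|u0] := leP 0 u.
  have := derive_le_increment u0 df dg (fun x _ => h x).
  by rewrite f0 !fctE /GRing.scale /= subr0 mulr0 subr0 (ger0_norm u0).
have := derive_le_increment (ltW u0) df dg (fun x _ => h x).
by rewrite f0 !fctE /GRing.scale /= sub0r mulr0 sub0r normrN -mulrN (ltr0_norm u0).
Qed.

(** The exponential is differentiated along the segment from B to A, on which
    its modulus is at most exp M. *)
Lemma cexp_lipschitz (A B : R[i]) (M : R) : Re A <= M -> Re B <= M ->
  `|Re (cexp A) - Re (cexp B)| <= normc (A - B) * expR M /\
  `|Im (cexp A) - Im (cexp B)| <= normc (A - B) * expR M.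
Proof.
move=> hA hB.
pose g (s : R) := B + (A - B) * s%:C.
have dg s : is_cderive g s (0 + (A - B) * 1).
  exact: (is_cderiveD (is_cderive_cst B s) (is_cderiveZ (A - B) (is_cderive_idC s))).
have dE s := is_cderive_exp (dg s).
have dl (s : R) : is_derive s (1 : R) ((normc (A - B) * expR M) *: id) (normc (A - B) * expR M).
  apply: (is_derive_eq (is_deriveZ _ (is_derive_id s (1 : R)))).
  by rewrite /GRing.scale /= mulr1.
have bound s : 0 < s < 1 -> normc ((0 + (A - B) * 1) * cexp (g s)) <= normc (A - B) * expR M.
  move=> s01; rewrite add0r mulr1 normcM normc_cexp; apply: ler_wpM2l; first exact: normc_ge0.
  rewrite ler_expR /g !ReImE /= mulr0 subr0.
  have [? ?] := andP s01.
  have -> : Re B + (Re A - Re B) * s = (1 - s) * Re B + s * Re A by ring.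
  by nra.
have g1 : g 1 = A by rewrite /g mulr1 addrC subrK.
have g0 : g 0 = B by rewrite /g mulr0 addr0.
split.
  have := derive_le_increment ler01 (fun s => proj1 (dE s)) dl
    (fun s hs => le_trans (normc_Re _) (bound s hs)).
  by rewrite /comp g1 g0 !fctE /GRing.scale /= mulr1 mulr0 subr0.
have := derive_le_increment ler01 (fun s => proj2 (dE s)) dl
  (fun s hs => le_trans (normc_Im _) (bound s hs)).
by rewrite /comp g1 g0 !fctE /GRing.scale /= mulr1 mulr0 subr0.
Qed.

End GrowthBounds.

(** * The line of steepest descent through the critical point *)

Section SaddleLine.
Context {R : realType}.
Local Notation mu := (@lebesgue_measure R).
Variables (e k : R) (b z t0 omega : R[i]).
Hypothesis he : e ^+ 2 = 1.
Hypothesis k0 : 0 < k.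
Hypothesis t0_neq0 : t0 != 0.
Hypothesis critical : z = t0 + b / 4 / t0.
Hypothesis omega1 : normc omega = 1.
Hypothesis omega_side : e * Im omega <= - (1 / 2).
Hypothesis omega_right : 0 <= Re (t0 * omega).

Let line (u : R) : R[i] := t0 * (1 + omega * u%:C).
Let diff (u : R) : R[i] := slitphase e b z (line u) - slitphase e b z t0.
Hypothesis descent : forall u, Re (diff u) <= - (k * u ^+ 2).

Let d : R[i] := - (t0 ^+ 2 / 2).
Let w : R[i] := - ((d + b / 8) * omega ^+ 2).

Let sqr_normc_t0_gt0 : 0 < normc t0 ^+ 2.
Proof. by rewrite exprn_gt0 // normc_gt0. Qed.

(** The signed distance from 0 to the line, up to the factor |t0 omega|, is
    the same at all points of the line.  Its positive sign means that the
    line passes 0 on the side away from the cut. *)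
Lemma line_invariant u :
  e * (Im (line u) * Re (t0 * omega) - Re (line u) * Im (t0 * omega)) =
  - (e * Im omega) * normc t0 ^+ 2.
Proof. by rewrite sqr_normcE /line !ReImE /=; ring. Qed.

Lemma line_invariant_gt0 : 0 < - (e * Im omega) * normc t0 ^+ 2.
Proof. by apply: mulr_gt0; [move: omega_side; lra | exact: sqr_normc_t0_gt0]. Qed.

(** Where the line meets the imaginary axis, the invariant reads
    e Im (line u) Re (t0 omega) > 0. *)
Lemma line_slit u : 0 < normc (line u) + e * Im (line u).
Proof.
apply: slit_plane_intro => //; have [E|] := eqVneq (Re (line u)) 0; [right|by left].
have := line_invariant_gt0; rewrite -(line_invariant u) E mul0r subr0 mulrA => h.
by rewrite ltNge; apply/negP => h2; move: omega_right h h2; nra.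
Qed.

Lemma line0 : line 0 = t0.
Proof. by rewrite /line mulr0 addr0 mulr1. Qed.

Lemma t0_slit : 0 < normc t0 + e * Im t0.
Proof. by have := line_slit 0; rewrite line0. Qed.

(** The distance from - 1 to the line of tau is |Im omega| >= 1 / 2. *)
Lemma normc_one_plus u : 1 / 2 <= normc (1 + omega * u%:C).
Proof.
rewrite -(ler_pXn2r (n := 2)) ?nnegrE ?normc_ge0 // sqr_normcE !ReImE /=.
have h := sqr_normcE omega; rewrite omega1 expr1n in h.
have h2 : 1 / 4 <= Im omega ^+ 2.
  have -> : Im omega ^+ 2 = (e * Im omega) ^+ 2 by rewrite exprMn he mul1r.
  by move: omega_side; nra.
have := sqr_ge0 (u + Re omega); nra.
Qed.

Lemma one_plus_neq0 u : 1 + omega * u%:C != 0.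
Proof. by rewrite -normc_gt0; have := normc_one_plus u; lra. Qed.

Lemma is_cderive_line_log u :
  is_cderive (fun u => slitlog e (line u)) u (omega / (1 + omega * u%:C)).
Proof.
have dl : is_cderive line u (t0 * (0 + omega * 1)).
  exact: (is_cderiveZ t0 (is_cderiveD (is_cderive_cst 1 u)
    (is_cderiveZ omega (is_cderive_idC u)))).
apply: (is_cderive_eq (is_cderive_slitlog he (line_slit u) dl)).
by rewrite /line; field; rewrite t0_neq0 one_plus_neq0.
Qed.

Let logdiff u := slitlog e (line u) - slitlog e t0.

Lemma is_cderive_logdiff u :
  is_cderive logdiff u (omega / (1 + omega * u%:C)).
Proof.
apply: (is_cderive_eq (is_cderiveB (is_cderive_line_log u) (is_cderive_cst (slitlog e t0) u))).
by rewrite subr0.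
Qed.

Lemma logdiff0 : logdiff 0 = 0.
Proof. by rewrite /logdiff line0 subrr. Qed.

Lemma is_cderive_tau u : is_cderive (fun u => omega * u%:C) u omega.
Proof.
by apply: (is_cderive_eq (is_cderiveZ omega (is_cderive_idC u))); rewrite mulr1.
Qed.

Lemma inv_one_plus_le u : (normc (1 + omega * u%:C))^-1 <= 2.
Proof.
have h := normc_one_plus u.
by rewrite -[leRHS]invrK lef_pV2 ?posrE ?invr_gt0 //; lra.
Qed.

(** The derivative omega - omega / (1 + tau) is at most 3; the estimate is used
    for large u. *)
Lemma tau_sub_log_le u : normc (omega * u%:C - logdiff u) <= 6 * `|u|.
Proof.
have dT v := is_cderiveB (is_cderive_tau v) (is_cderive_logdiff v).
have bd v : normc (omega - omega / (1 + omega * v%:C)) <= 3.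
  apply: (le_trans (le_normcD _ _)); rewrite normcN normcM normcV omega1 mul1r.
  by have := inv_one_plus_le v; lra.
have T0 : omega * (0 : R)%:C - logdiff 0 = 0 by rewrite logdiff0 mulr0 subr0.
have hR := derive_le_linear u (fun v => proj1 (dT v)) (congr1 Re T0)
  (fun v => le_trans (normc_Re _) (bd v)).
have hI := derive_le_linear u (fun v => proj2 (dT v)) (congr1 Im T0)
  (fun v => le_trans (normc_Im _) (bd v)).
apply: (le_trans (normc_le _)); apply: (le_trans (lerD hR hI)); lra.
Qed.

Let cubic u := omega * u%:C - (2^-1)%:C * (omega * u%:C * (omega * u%:C)) - logdiff u.

(** The derivative of tau - tau^2 / 2 - log (1 + tau) is
    - omega tau^2 / (1 + tau), of modulus at most 2 u^2. *)
Lemma cubic_le u : normc (cubic u) <= 4 / 3 * `|u| ^+ 3.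
Proof.
have dQ v := is_cderiveB (is_cderiveB (is_cderive_tau v)
  (is_cderiveZ (2^-1)%:C (is_cderiveM (is_cderive_tau v) (is_cderive_tau v))))
  (is_cderive_logdiff v).
have half : (2^-1)%:C = 2^-1 :> R[i] by rewrite rmorphV ?unitfE // rmorphMn.
have bd v : normc (omega - (2^-1)%:C * (omega * (omega * v%:C) + omega * v%:C * omega)
    - omega / (1 + omega * v%:C)) <= 3 * (2 / 3) * v ^+ 2.
  rewrite (_ : _ - _ - _ = - (omega * (omega * v%:C) ^+ 2 / (1 + omega * v%:C))); last first.
    by rewrite half; field; exact: one_plus_neq0.
  rewrite normcN normcM normcV normcM normcX normcM omega1 !mul1r normc_real real_normK ?num_real //.
  rewrite mulrC; have := inv_one_plus_le v; have := sqr_ge0 v; nra.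
have Q0 : cubic 0 = 0 by rewrite /cubic logdiff0 !mulr0 subr0 subr0.
have hR := derive_le_cubic u (fun v => proj1 (dQ v)) (congr1 Re Q0)
  (fun v => le_trans (normc_Re _) (bd v)).
have hI := derive_le_cubic u (fun v => proj2 (dQ v)) (congr1 Im Q0)
  (fun v => le_trans (normc_Im _) (bd v)).
apply: (le_trans (normc_le _)); apply: (le_trans (lerD hR hI)); lra.
Qed.

Lemma diff_logdiffE u : diff u = d * omega ^+ 2 * u%:C ^+ 2 + b / 4 * (omega * u%:C - logdiff u).
Proof.
by rewrite /diff /slitphase -/(logdiff u) /d /logdiff /line critical; field.
Qed.

Lemma diff_cubicE u : diff u = - (w * u%:C ^+ 2) + b / 4 * cubic u.
Proof.
have half : (2^-1)%:C = 2^-1 :> R[i] by rewrite rmorphV ?unitfE // rmorphMn.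
by rewrite diff_logdiffE /cubic /w half; field.
Qed.

Lemma Re_mul_sqr (c : R[i]) (u : R) : Re (c * u%:C ^+ 2) = Re c * u ^+ 2.
Proof. by rewrite -rmorphXn Re_mul /= mulr0 subr0. Qed.

Lemma Re_ge_normc (c : R[i]) : - normc c <= Re c.
Proof. by have := normc_Re c; rewrite ler_norml => /andP[]. Qed.

(** In the descent inequality, divide by u^2 and let u tend to 0: the remainder
    is cubic. *)
Lemma Re_w_ge : k <= Re w.
Proof.
rewrite leNgt; apply/negP => hk.
pose C := normc (b / 4) * (4 / 3).
have C0 : 0 <= C by rewrite mulr_ge0 ?normc_ge0 //; lra.
pose D := k - Re w; have D0 : 0 < D by rewrite subr_gt0.
have key u : 0 < u -> D <= C * u.
  move=> u0; have := descent u; rewrite diff_cubicE Re_add Re_opp Re_mul_sqr => h.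
  have h1 : - (C * u ^+ 3) <= Re (b / 4 * cubic u).
    apply: (le_trans _ (Re_ge_normc _)); rewrite lerN2 normcM -mulrA.
    by apply: ler_wpM2l; [exact: normc_ge0|have := cubic_le u; rewrite (gtr0_norm u0)].
  have u2 : 0 < u ^+ 2 by rewrite exprn_gt0.
  by rewrite -(ler_pM2r u2) -mulrA -exprS /D; lra.
(* A u with C u < D contradicts the inequality. *)
have C1 : 0 < 2 * (C + 1) by lra.
have u0 : 0 < D / (2 * (C + 1)) by rewrite divr_gt0.
have := key _ u0; rewrite mulrA ler_pdivlMr //; nra.
Qed.

(** In the descent inequality, divide by u^2 and let u tend to infinity: what
    is left besides d tau^2 grows linearly. *)
Lemma Re_d_le : Re (d * omega ^+ 2) <= - k.
Proof.
rewrite leNgt; apply/negP => hk.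
pose C := normc (b / 4) * 6.
have C0 : 0 <= C by rewrite mulr_ge0 ?normc_ge0.
pose D := Re (d * omega ^+ 2) + k; have D0 : 0 < D by rewrite /D; lra.
have key u : 0 < u -> D * u <= C.
  move=> u0; have := descent u; rewrite diff_logdiffE Re_add Re_mul_sqr => h.
  have h1 : - (C * u) <= Re (b / 4 * (omega * u%:C - logdiff u)).
    apply: (le_trans _ (Re_ge_normc _)); rewrite lerN2 normcM -mulrA.
    by apply: ler_wpM2l; [exact: normc_ge0|have := tau_sub_log_le u; rewrite (gtr0_norm u0)].
  by rewrite -(ler_pM2r u0) -mulrA -expr2 /D; lra.
(* A u with C < D u contradicts the inequality. *)
have u0 : 0 < (C + 1) / D by rewrite divr_gt0 //; lra.
have := key _ u0; rewrite mulrCA mulfV ?gt_eqF //; lra.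
Qed.

(** d omega^2 is - (t0 omega)^2 / 2, and its real part is negative. *)
Lemma direction_slope : `|Im (t0 * omega)| < Re (t0 * omega).
Proof.
have := Re_d_le.
rewrite (_ : d * omega ^+ 2 = (- 2^-1)%:C * (t0 * omega * (t0 * omega))); last first.
  by rewrite rmorphN rmorphV ?unitfE // rmorphMn /d; field.
move: omega_right; set q := t0 * omega => q0.
rewrite [Re (_ * (q * q))]Re_mul [Re (q * q)]Re_mul /= mul0r subr0 => h.
have hq : Im q ^+ 2 < Re q ^+ 2 by move: k0 h; rewrite expr2; nra.
by rewrite ltr_norml; apply/andP; split; nra.
Qed.

Lemma tame_descent : tame (fun u => cexp (diff u)).
Proof.
split.
  have dD u := is_cderiveB (is_cderiveZ (d * omega ^+ 2)
    (is_cderiveM (is_cderive_idC u) (is_cderive_idC u))) (is_cderive_cst 0 u).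
  have dT u := is_cderiveB (is_cderive_tau u) (is_cderive_logdiff u).
  have dA u := is_cderive_exp (is_cderiveD (dD u) (is_cderiveZ (b / 4) (dT u))).
  rewrite (_ : (fun u => cexp (diff u)) = cexp \o (fun u =>
    d * omega ^+ 2 * (u%:C * u%:C) - 0 + b / 4 * (omega * u%:C - logdiff u))).
    by eexists => u; exact: dA.
  by apply/funext => u; rewrite /comp diff_logdiffE subr0 expr2.
exists 0, k; split => // u; rewrite normc_cexp /envelope mul0r sub0r ler_expR.
exact: descent.
Qed.

(** The line is put in the form [line_point e y0 m], the contour is moved onto
    it, and the abscissa x = Re t0 + Re (t0 omega) u is replaced by u. *)
Lemma cintegral_line :
  cintegral (fun x => pcf_integrand e b z (x +i* e)) =
  cexp (slitphase e b z t0) * (t0 * omega) * cintegral (fun u => cexp (diff u)).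
Proof.
have slope := direction_slope.
set q := t0 * omega in slope *.
have q0 : 0 < Re q by exact: le_lt_trans slope.
pose m := e * (Im q / Re q).
pose y0 := e * (Im t0 * Re q - Re t0 * Im q) / Re q.
have e1 : `|e| = 1.
  by apply/eqP; rewrite -(eqrXn2 (n := 2)) // expr1n real_normK ?num_real // he.
have m1 : `|m| < 1.
  by rewrite /m normrM e1 mul1r normrM normfV (gtr0_norm q0) ltr_pdivrMr // mul1r.
have y00 : 0 < y0.
  have := line_invariant 0; rewrite line0 -/q => E.
  by rewrite divr_gt0 // E line_invariant_gt0.
have hl u : line u = t0 + q * u%:C by rewrite /line /q; ring.
clearbody q.
rewrite (contour_shift b z he y00 m1).
have m01 : 0 <= `|m| < 1 by rewrite normr_ge0.
have [K [c [K0 c0 bnd]]] := pcf_integrand_bound b z y0 he y00 m01.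
have tG : tame (fun x => pcf_integrand e b z (line_point e y0 m x)).
  split.
    have dl x : is_cderive (line_point e y0 m) x (1 +i* (e * m)).
      apply: (is_cderive_pair (is_derive_id x (1 : R))).
      have h := is_deriveZ e (is_deriveD (is_derive_cst y0 x 1)
        (is_deriveZ m (is_derive_id x (1 : R)))).
      by apply: (is_derive_eq h); rewrite /GRing.scale /=; ring.
    by eexists => x; exact: (is_cderive_pcf_integrand b z he (line_point_slit m x he y00) (dl x)).
  exists K, c; split => // x.
  by case: (bnd y0 m x _ (lexx _)) => //; rewrite lexx.
have -> : (fun x => pcf_integrand e b z (line_point e y0 m x) * (1 +i* (e * m))) =
    (fun x => (1 +i* (e * m)) * pcf_integrand e b z (line_point e y0 m x)).
  by apply/funext => x; rewrite mulrC.
rewrite (cintegralZ _ tG) (cintegral_affine (Re t0) q0 tG).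
have -> : (fun x => pcf_integrand e b z (line_point e y0 m (Re t0 + Re q * x))) =
    (fun u => cexp (slitphase e b z t0) * cexp (diff u)).
  apply/funext => u; rewrite -cexpD /diff [X in _ = cexp X]addrC subrK /pcf_integrand.
  congr (cexp (slitphase _ _ _ _)).
  apply: complexP; rewrite hl !ReImE /=; first by ring.
  rewrite /y0 /m.
  rewrite (_ : e * _ = e ^+ 2 * ((Im t0 * Re q - Re t0 * Im q) / Re q +
    Im q / Re q * (Re t0 + Re q * u))); last by ring.
  by rewrite he; field; rewrite gt_eqF.
rewrite (cintegralZ _ tame_descent).
have qE : (1 +i* (e * m)) * (Re q)%:C = q.
  apply: complexP; rewrite !ReImE /= mulr0 ?subr0 ?add0r ?mul1r //.
  rewrite /m (_ : e * _ * _ = e ^+ 2 * (Im q / Re q * Re q)); last by ring.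
  by rewrite he divfK ?mul1r // gt_eqF.
by rewrite mulrA qE mulrA; congr (_ * cintegral _); exact: mulrC.
Qed.

(** Both exponents have real part at most - k u^2 and differ by
    (b / 4) [cubic u]; the constant is 2 * (1/4) * (4/3), the factor 2 coming
    from treating real and imaginary parts separately. *)
Lemma gaussian_approx :
  normc (cintegral (fun u => cexp (diff u)) -
         cintegral (fun u => cexp (- (w * u%:C ^+ 2)))) <=
  2 / 3 * (normc b / k ^+ 2).
Proof.
have w0 : 0 < Re w by apply: lt_le_trans Re_w_ge.
have [i3 e3] := integral_cubic_gauss k0.
have i3' : mu.-integrable setT (EFin \o (fun u => normc b / 3 *
    (`|u| ^+ 3 * expR (- (k * u ^+ 2))))).
  exact: (integrableZl measurableT (normc b / 3) i3).
have bd u : normc (diff u - - (w * u%:C ^+ 2)) * expR (- (k * u ^+ 2)) <=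
    normc b / 3 * (`|u| ^+ 3 * expR (- (k * u ^+ 2))).
  rewrite [leRHS]mulrA; apply: ler_wpM2r; first exact: expR_ge0.
  rewrite diff_cubicE addrC addKr !normcM normcV normc_nat.
  have := cubic_le u; have := normc_ge0 b; set B := normc b => B0 h.
  apply: (le_trans (ler_wpM2l _ h)); first by rewrite mulr_ge0.
  by lra.
have hw u : Re (- (w * u%:C ^+ 2)) <= - (k * u ^+ 2).
  rewrite Re_opp Re_mul_sqr lerN2; apply: ler_wpM2r; first exact: sqr_ge0.
  exact: Re_w_ge.
have lip u := cexp_lipschitz (descent u) (hw u).
apply: (le_trans (normc_cintegralB tame_descent (tame_gauss w0) i3' _ _)).
- by move=> u; exact: le_trans (lip u).1 (bd u).
- by move=> u; exact: le_trans (lip u).2 (bd u).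
rewrite RintegralZl // e3.
by rewrite le_eqVlt; apply/orP; left; apply/eqP; field; rewrite gt_eqF.
Qed.

End SaddleLine.

(** * The parabolic cylinder function *)

(** Re V^2 > 0 says that V lies within 45 degrees of the real axis. *)
Lemma sqrt_near_real_direction (R : realType) (c : R[i]) : 0 < Re c ->
  exists V : R[i], V ^+ 2 = c /\ `|Im V| < Re V.
Proof.
move=> c0; pose S := sqrtC c.
have SE : S ^+ 2 = c := sqrtCK c.
have h : Im S ^+ 2 < Re S ^+ 2.
  by move: c0; rewrite -SE expr2 Re_mul !expr2; lra.
have hs (V : R[i]) : 0 <= Re V -> Im V ^+ 2 < Re V ^+ 2 -> `|Im V| < Re V.
  by move=> V0 hV; rewrite ltr_norml; apply/andP; split; nra.
have [S0|S0] := leP 0 (Re S); first by exists S; split => //; exact: hs.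
exists (- S); rewrite sqrrN; split => //; apply: hs; rewrite Re_opp ?Im_opp ?sqrrN //; lra.
Qed.

Lemma pcf_cintegralE (R : realType) (up : bool) (a z : R[i]) :
  pcf up a z = cexp (- (z ^+ 2 / 4)) * cintegral (fun x : R =>
    pcf_integrand (sgn_of_side up) (- 4 * (a - 1 / 2)) z (x +i* sgn_of_side up)).
Proof.
rewrite /pcf; congr (_ * cintegral _); apply/funext => x.
set e := sgn_of_side up.
have ctE : contour up x = x +i* e by [].
have he : e ^+ 2 = 1 := sgn_of_side_sqr up.
rewrite /= -clog_cont_contour ctE clog_contE; last first.
  by apply: slit_plane_intro => //=; right; rewrite -expr2 he.
rewrite -cexpD /pcf_integrand; congr cexp; rewrite /slitphase.
by rewrite -/e; field.
Qed.

Unset Implicit Arguments.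

Theorem theorem3p3 (R : realType) (a z t0 : R[i]) (beta delta kappa alpha : R) :
  (forall n : nat, a <> n%:R + 1 / 2) ->
  let b : R[i] := - 4 * (a - 1 / 2) in
  t0 = 1 / 2 * (z + sqrtC (z ^+ 2 - b)) \/
  t0 = 1 / 2 * (z - sqrtC (z ^+ 2 - b)) ->
  let d : R[i] := - (t0 ^+ 2 / 2) in
  let rho : R := normc (b / (8 * d)) in
  - pi <= beta <= pi -> b = (normc b)%:C * cis beta ->
  - pi <= delta <= pi -> d = (normc d)%:C * cis delta ->
  is_kappa rho beta delta kappa ->
  0 < kappa ->
  0 <= alpha < pi ->
  corresponding_angle b z t0 d kappa alpha ->
  let up := upper_side t0 alpha in
  exists s : R[i],
    s ^+ 2 = - 8 * d - b /\
    normc (pcf up a z / pcf_approx up b z t0 s - 1) <=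
      Num.sqrt (normc (8 * d + b)) * normc b / (kappa ^+ 2 * normc d ^+ 2) *
      (1 + ln (1 + (kappa * normc d) `^ (3 / 2) / normc b) ^+ 2).
Proof.
move=> ha b ht0 d rho _ _ _ _ _ kappa0 _ [sin_ge hdescent] up.
have b0 : b != 0.
  rewrite mulf_neq0 ?oppr_eq0 ?pnatr_eq0 // subr_eq0; apply/eqP => a2.
  by apply: (ha 0%N); rewrite add0r.
have quad : t0 ^+ 2 - z * t0 + b / 4 = 0.
  have S2 : sqrtC (z ^+ 2 - b) ^+ 2 = z ^+ 2 - b := sqrtCK _.
  case: ht0 => ->; move: S2; set S := sqrtC _ => S2.
    rewrite (_ : _ + _ = (S ^+ 2 - (z ^+ 2 - b)) / 4); first by rewrite S2 subrr mul0r.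
    by field.
  rewrite (_ : _ + _ = (S ^+ 2 - (z ^+ 2 - b)) / 4); first by rewrite S2 subrr mul0r.
  by field.
have t00 : t0 != 0.
  apply/eqP => t00; move: quad; rewrite t00 expr0n mulr0 subr0 add0r => /eqP.
  by rewrite mulf_eq0 (negbTE b0) invr_eq0 pnatr_eq0.
have crit : z = t0 + b / 4 / t0.
  apply: (mulIf t00); rewrite mulrDl divfK // -expr2.
  by apply/eqP; rewrite -subr_eq0 -oppr_eq0 -quad; apply/eqP; ring.
have d0 : 0 < normc d.
  by rewrite normc_gt0 oppr_eq0 mulf_neq0 ?invr_eq0 ?pnatr_eq0 // expf_neq0.
set e : R := sgn_of_side up.
have he : e ^+ 2 = 1 := sgn_of_side_sqr up.
pose k := kappa * normc d.
have k0 : 0 < k by rewrite mulr_gt0.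
(* The sign - e orients the line to the right in both cases. *)
pose omega : R[i] := (- e)%:C * cis alpha.
have omega1 : normc omega = 1.
  rewrite normcM normc_cis mulr1 normc_real normrN.
  by apply/eqP; rewrite -(eqrXn2 (n := 2)) // expr1n real_normK ?num_real // he.
have omega_side : e * Im omega <= - (1 / 2).
  rewrite /omega Im_mul /= mul0r addr0 mulrA mulrN -expr2 he; lra.
have omega_right : 0 <= Re (t0 * omega).
  rewrite /omega mulrCA Re_mul /= mul0r subr0.
  have : up = (Re (t0 * cis alpha) < 0) by [].
  rewrite /e; case: (up) => h; rewrite /= ?opprK ?mul1r ?mulN1r.
    by rewrite oppr_ge0 ltW // -h.
  by rewrite leNgt -h.
have slit := line_slit he t00 omega_side omega_right.
have phaseE t : 0 < normc t + e * Im t -> phase up b z t = slitphase e b z t.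
  by move=> ht; rewrite /phase /slitphase clog_contE.
have t0s := t0_slit he t00 omega_side omega_right.
have descent u : Re (slitphase e b z (t0 * (1 + omega * u%:C)) - slitphase e b z t0)
    <= - (k * u ^+ 2).
  rewrite -!phaseE //.
  have := hdescent (- e * u).
  have -> : cis alpha * (- e * u)%:C = omega * u%:C.
    by rewrite /omega rmorphM mulrCA mulrA.
  move=> h; apply: (le_trans h); rewrite normcM omega1 mul1r normc_real.
  by rewrite real_normK ?num_real.
set w := - ((d + b / 8) * omega ^+ 2).
have wk : k <= Re w := Re_w_ge he t00 crit omega1 omega_side omega_right descent.
have line_eq := cintegral_line he k0 t00 crit omega1 omega_side omega_right descent.
have approx := gaussian_approx he k0 t00 crit omega1 omega_side omega_right descent.
have [V [V2 Vslope]] : exists V : R[i], V ^+ 2 = 2 * w /\ `|Im V| < Re V.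
  apply: sqrt_near_real_direction.
  by rewrite mulr_natl mulr2n Re_add; lra.
have V0 : V != 0.
  by apply/eqP => V0; move: Vslope; rewrite V0 /= normr0 ltxx.
have gauss := complex_gauss Vslope.
have w2 : 2 * w / 2 = w by rewrite mulrAC divff ?mul1r // pnatr_eq0.
rewrite V2 w2 in gauss.
move: approx line_eq; set I := cintegral (fun u : R => cexp (_ - _)).
rewrite -/w; set G := cintegral _ => approx line_eq.
have GE : V * G = (Num.sqrt (2 * pi))%:C := gauss.
have omega0 : omega != 0 by rewrite -normc_gt0 omega1.
pose c : R := Num.sqrt (2 * pi).
have c2 : 2 <= c.
  have pi2 := @pi_ge2 R.
  rewrite -(ler_pXn2r (n := 2)) ?nnegrE ?sqrtr_ge0 // sqr_sqrtr; lra.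
have cC0 : c%:C != 0 :> R[i] by rewrite -normc_gt0 normc_real gtr0_norm; lra.
(* With this s, 2 sqrt (2 pi) / s is omega G. *)
exists (2 * V / omega); split.
  rewrite !exprMn exprVn V2 /w; field; exact: omega0.
have ratio : pcf up a z / pcf_approx up b z t0 (2 * V / omega) - 1 = (I - G) * V / c%:C.
  rewrite pcf_cintegralE line_eq /pcf_approx phaseE //.
  rewrite (cexpD (- (z ^+ 2 / 4)) (slitphase e b z t0)).
  have -> : (2 * Num.sqrt (2 * pi))%:C = 2 * c%:C :> R[i] by rewrite rmorphM rmorphMn.
  have GV : G = c%:C / V by rewrite /c -GE mulrAC mulfV // mul1r.
  rewrite GV; move: (cexp_neq0 (- (z ^+ 2 / 4))) (cexp_neq0 (slitphase e b z t0)).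
  set E1 := cexp _; set E2 := cexp _ => E1n E2n.
  by clearbody I omega E1 E2 c; field; rewrite V0 omega0 E1n E2n t00 cC0.
rewrite ratio (normcM ((I - G) * V)) (normcM (I - G)) normcV normc_real (ger0_norm (_ : 0 <= c)); last by lra.
have NV : normc V = Num.sqrt (normc (8 * d + b)) / 2.
  have h : normc V ^+ 2 = (Num.sqrt (normc (8 * d + b)) / 2) ^+ 2.
    rewrite -normcX V2 exprMn sqr_sqrtr ?normc_ge0 //.
    rewrite (_ : 2 * w = - ((8 * d + b) * omega ^+ 2 / 4)); last by rewrite /w; field.
    rewrite normcN 2!normcM normcX omega1 expr1n mulr1 normcV normc_nat.
    by rewrite exprVn; congr (_ / _); rewrite -natrX.
  apply/eqP; rewrite -(eqrXn2 (n := 2)) ?normc_ge0 ?divr_ge0 ?sqrtr_ge0 //.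
  exact/eqP.
rewrite NV.
set N := Num.sqrt (normc (8 * d + b)).
have N0 : 0 <= N by rewrite sqrtr_ge0.
have k2 : kappa ^+ 2 * normc d ^+ 2 = k ^+ 2 by rewrite exprMn.
rewrite k2.
have base0 : 0 <= N * normc b / k ^+ 2.
  by apply: divr_ge0 (sqr_ge0 k); apply: mulr_ge0 (normc_ge0 b).
(* The bracket with the logarithm is at least 1. *)
apply: (@le_trans _ _ (N * normc b / k ^+ 2)); last first.
  by rewrite ler_peMr // lerDl sqr_ge0.
have B0 : 0 <= normc b / k ^+ 2 by rewrite divr_ge0 ?normc_ge0 ?sqr_ge0.
rewrite ler_pdivrMr; last by lra.
apply: (@le_trans _ _ (2 / 3 * (normc b / k ^+ 2) * (N / 2))).
  by apply: ler_wpM2r; [lra | exact: approx].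
rewrite -[N * _ / _]mulrA; set B := normc b / _ in B0 *.
by have := mulr_ge0 N0 B0; nra.
Qed.
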